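(* Let $(\widetilde{\mathfrak g},H_0)$ be a simple regular graded Lie algebra over $F$ of rank $k+1$, and let $(I^-,H_0,I^+)$, $I^+=X_0+\dots+X_k$, $I^-=Y_0+\dots+Y_k$, be a diagonal $\mathfrak{sl}_2$-triple such that $\gamma_{i,k-i}(X_i)=X_{k-i}$ for $0\le i\le n$, where $n$ is defined by $k=2n+2$ if $k$ is even and $k=2n+1$ if $k$ is odd. Then there exists an element $\gamma\in N_{\widetilde G}(\mathfrak a^0)$ such that (1) $\gamma.H_{\lambda_j}=-H_{\lambda_{k-j}}$ for $j=0,\dots,k$; (2) $\gamma.X_j=Y_{k-j}$ for $j=0,\dots,k$; (3) $\gamma^2=\mathrm{Id}_{\widetilde{\mathfrak g}}$. Such an element normalizes $\mathfrak g$, exchanges $V^+$ and $V^-$, and normalizes $G$, $P$, $L$, $A^0$ and $N$.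
   Context: Setting. $F$ is a finite extension of $\mathbb Q_p$ whose residue field has characteristic $\neq 2$; $\overline F$ is an algebraic closure and $\overline U=U\otimes_F\overline F$. A regular graded Lie algebra is a reductive Lie algebra $\widetilde{\mathfrak g}$ over $F$ with an element $H_0$ such that (H1) $\widetilde{\mathfrak g}=V^-\oplus\mathfrak g\oplus V^+$ with $V^+\ne 0$, where $V^-,\mathfrak g,V^+$ are the eigenspaces of $\operatorname{ad}H_0$ for $-2,0,2$; (H2) the bracket representation of $\mathfrak g$ on $\overline{V^+}$ is irreducible; (H3) there are elements of $V^-$ and $V^+$ forming with $H_0$ an $\mathfrak{sl}_2$-triple. Convention: $(Y,H,X)$ is an $\mathfrak{sl}_2$-triple if $[H,X]=2X$, $[H,Y]=-2Y$, $[Y,X]=H$. Roots and descent. $\mathfrak a$ is a maximal split abelian subalgebra of $\mathfrak g$ containing $H_0$; $\widetilde\Sigma$ is the root system of $(\widetilde{\mathfrak g},\mathfrak a)$, $\widetilde{\mathfrak g}^\lambda$ the root spaces, $H_\lambda\in\mathfrak a$ the coroot of $\lambda$. Fix a basis $\widetilde\Pi$ of $\widetilde\Sigma$ with $\nu(H_0)\in\{0,2\}$ for all $\nu\in\widetilde\Pi$; exactly one simple root, $\lambda_0$, satisfies $\lambda_0(H_0)=2$. Inductively, $\lambda_j$ is the unique simple root with $\lambda_j(H_0)=2$ of the system $\widetilde\Sigma_j$ of roots of $\widetilde\Sigma$ strongly orthogonal to $\lambda_0,\dots,\lambda_{j-1}$, ordered by $\widetilde\Sigma^+\cap\widetilde\Sigma_j$;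 the process stops at $\lambda_k$, when no root $\lambda$ with $\lambda(H_0)=2$ is strongly orthogonal to $\lambda_0,\dots,\lambda_k$. The rank is $k+1$. $\mathfrak a^0=\bigoplus_{j=0}^kFH_{\lambda_j}$; $E_{i,j}(p,q)=\{X\in\widetilde{\mathfrak g}:[H_{\lambda_i},X]=pX,[H_{\lambda_j},X]=qX,[H_{\lambda_s},X]=0\ (s\ne i,j)\}$. Groups. $\widetilde G=\mathrm{Aut}_0(\widetilde{\mathfrak g})$ is the group of automorphisms of $\widetilde{\mathfrak g}$ which become elementary (finite products of $e^{\operatorname{ad}x}$, $\operatorname{ad}x$ nilpotent) over $\overline F$; $G=\{g\in\widetilde G:g.H_0=H_0\}$; $L=Z_G(\mathfrak a^0)$; $N=\exp(\operatorname{ad}\mathfrak n)$ with $\mathfrak n=\bigoplus_{i<j}E_{i,j}(1,-1)$; $P=LN$; $A^0$ is the split torus of $G$ with Lie algebra $\mathfrak a^0$. Diagonal triple: $X_j\in\widetilde{\mathfrak g}^{\lambda_j}\setminus\{0\}$, $Y_j\in\widetilde{\mathfrak g}^{-\lambda_j}\setminus\{0\}$ and each $(Y_j,H_{\lambda_j},X_j)$ is an $\mathfrak{sl}_2$-triple. For $i\neq j$, one fixes an $\mathfrak{sl}_2$-triple $(Y,H_{\lambda_i}-H_{\lambda_j},X)$ with $X\in E_{i,j}(1,-1)$, $Y\in E_{i,j}(-1,1)$ (it exists) and puts $\gamma_{i,j}=e^{\operatorname{ad}X}e^{\operatorname{ad}Y}e^{\operatorname{ad}X}\in G$; $\gamma_{i,j}$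 exchanges $H_{\lambda_i}$ and $H_{\lambda_j}$, fixes $H_{\lambda_s}$ for $s\ne i,j$, acts trivially on $\widetilde{\mathfrak g}^{\lambda_s}$ for $s\neq i,j$, and maps $\widetilde{\mathfrak g}^{\lambda_i}$ onto $\widetilde{\mathfrak g}^{\lambda_j}$. *)

(* Defs.v *)
(* Finite-dimensional Lie algebras are vectTypes with a
   bracket, infinite groups are Prop-valued predicates on endomorphisms. *)
From HB Require Import structures.
From mathcomp Require Import all_boot all_order all_algebra all_field.

Set Implicit Arguments.
Unset Strict Implicit.
Unset Printing Implicit Defensive.

Import Order.TTheory GRing.Theory Num.Theory.
Local Open Scope ring_scope.

Definition padic_abs (p : nat) (q : rat) : rat :=
  if q == 0 then 0
  else p%:R ^ ((logn p `|denq q|%N)%:Z - (logn p `|numq q|%N)%:Z).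

(* (K, nu) is the completion of rat for the p-adic absolute value.  All the
   values of that absolute value are rational, so nu takes values in rat. *)
Record is_Qp (p : nat) (K : fieldType) (nu : K -> rat) : Prop := IsQp {
  Qp_prime : prime p;
  Qp_abs0 : forall x, nu x = 0 <-> x = 0;
  Qp_absM : forall x y, nu (x * y) = nu x * nu y;
  Qp_absD : forall x y, nu (x + y) <= Num.max (nu x) (nu y);
  Qp_rat : forall q : rat, nu (ratr q) = padic_abs p q;
  Qp_dense : forall (x : K) (e : rat), 0 < e -> exists q, nu (x - ratr q) < e;
  Qp_complete : forall u : nat -> K,
    (forall e : rat, 0 < e -> exists N : nat, forall m n,
       (N <= m)%N -> (N <= n)%N -> nu (u m - u n) < e) ->
    exists l : K, forall e : rat, 0 < e -> exists N : nat, forall m,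
       (N <= m)%N -> nu (u m - l) < e }.

Section LocalField.
Variables (K : fieldType) (nu : K -> rat) (F : fieldExtType K).

(* The ring of integers of F is the integral closure of the valuation ring. *)
Definition in_integer_ring (x : F) : Prop :=
  exists q : {poly K}, [/\ q \is monic, (forall i, nu q`_i <= 1)
                         & root (map_poly (in_alg F) q) x].

Definition in_maximal_ideal (x : F) : Prop :=
  in_integer_ring x /\ ~ (x != 0 /\ in_integer_ring x^-1).

(* 2 is not 0 in the quotient of the integer ring by its maximal ideal. *)
Definition residue_char_neq2 : Prop := ~ in_maximal_ideal 2%:R.

End LocalField.

Section LieAlgebra.
Variables (F : fieldType) (V : vectType F) (br : V -> V -> V).

Record lie_bracket : Prop := LieBracket {
  lie_linearl : forall y, linear (br^~ y);
  lie_linearr : forall x, linear (br x);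
  lie_alt : forall x, br x x = 0;
  lie_jacobi : forall x y z,
    br x (br y z) + br y (br z x) + br z (br x y) = 0 }.

Definition ad (x : V) : 'End(V) := linfun (br x).

Definition lie_ideal (I : {vspace V}) : Prop :=
  forall x y, y \in I -> br x y \in I.

(* The adjoint representation is completely reducible. *)
Definition reductive : Prop :=
  forall I : {vspace V}, lie_ideal I ->
  exists J : {vspace V}, [/\ lie_ideal J, (I + J)%VS = fullv & (I :&: J)%VS = 0%VS].

Definition lie_simple : Prop :=
  (exists x y, br x y != 0) /\
  (forall I : {vspace V}, lie_ideal I -> I = 0%VS \/ I = fullv).

(* The sign convention is [Y, X] = H. *)
Definition sl2_triple (Y H X : V) : Prop :=
  [/\ br H X = 2%:R *: X, br H Y = - (2%:R *: Y) & br Y X = H].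

Definition iter_lfun (m : nat) (f : 'End(V)) : 'End(V) :=
  iter m (fun g => (f \o g)%VF) \1%VF.

Definition nilpotent_end (f : 'End(V)) : Prop := exists m, iter_lfun m f = 0.

(* The exponential of a nilpotent f: all later terms of the series vanish. *)
Definition exp_nilp (f : 'End(V)) : 'End(V) :=
  \sum_(m < (\dim {:V}).+1) (m`!%:R)^-1 *: iter_lfun m f.

Definition exp_ad (x : V) : 'End(V) := exp_nilp (ad x).

Definition elementary (g : 'End(V)) : Prop :=
  exists s : seq V, (forall x, x \in s -> nilpotent_end (ad x)) /\
    g = foldr (fun x h => (exp_ad x \o h)%VF) \1%VF s.

Definition lie_automorphism (g : 'End(V)) : Prop :=
  lker g = 0%VS /\ forall x y, g (br x y) = br (g x) (g y).

Definition diagonalizable_end (f : 'End(V)) : Prop :=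
  exists2 b : seq V, basis_of fullv b
    & forall v, v \in b -> exists c : F, f v = c *: v.

Definition eigenspace_ad (H : V) (c : F) : {vspace V} :=
  lker (ad H - c *: \1%VF).

End LieAlgebra.

(* Extension of scalars along iota : F -> Fbar, in coordinates: V (x) Fbar is the space of Fbar-valued coordinate vectors with
   respect to the basis [vbasis fullv] of V. *)

Section BaseChange.
Variables (F : fieldType) (Fbar : fieldType) (iota : {rmorphism F -> Fbar}).
Variables (V : vectType F) (br : V -> V -> V).

Definition bar_space : vectType Fbar := 'rV[Fbar]_(\dim {:V}).

Definition bar_vec (x : V) : bar_space :=
  \row_i iota (coord (vbasis {:V}) i x).

Definition bar_sub (U : {vspace V}) : {vspace bar_space} :=
  <<[seq bar_vec x | x <- vbasis U]>>%VS.

Definition bar_br (u v : bar_space) : bar_space :=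
  \sum_(i < \dim {:V}) \sum_(j < \dim {:V})
    ((u : 'rV_ _) 0 i * (v : 'rV_ _) 0 j) *:
      bar_vec (br (vbasis {:V})`_i (vbasis {:V})`_j).

Definition bar_end (f : 'End(V)) : 'End(bar_space) :=
  linfun (fun u : bar_space =>
    \sum_(i < \dim {:V}) (u : 'rV_ _) 0 i *: bar_vec (f (vbasis {:V})`_i)).

Definition Aut0 (g : 'End(V)) : Prop :=
  lie_automorphism br g /\ elementary bar_br (bar_end g).

End BaseChange.

Section Graded.
Variables (F : fieldType) (Fbar : fieldType) (iota : {rmorphism F -> Fbar}).
Variables (V : vectType F) (br : V -> V -> V) (H0 : V).

Definition Vplus : {vspace V} := eigenspace_ad br H0 2%:R.
Definition Vminus : {vspace V} := eigenspace_ad br H0 (- 2%:R).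
Definition g0 : {vspace V} := eigenspace_ad br H0 0.

Record regular_graded : Prop := RegularGraded {
  rg_reductive : reductive br;
  rg_sum : (Vminus + g0 + Vplus)%VS = fullv;
  rg_direct : directv (Vminus + g0 + Vplus);
  rg_Vplus : Vplus != 0%VS;
  rg_irreducible : forall W : {vspace bar_space Fbar V},
    (W <= bar_sub iota Vplus)%VS ->
    (forall x w, x \in g0 -> w \in W -> bar_br iota br (bar_vec iota x) w \in W) ->
    W = 0%VS \/ W = bar_sub iota Vplus;
  rg_sl2 : exists Y X, [/\ Y \in Vminus, X \in Vplus & sl2_triple br Y H0 X] }.

End Graded.

Section Roots.
Variables (F : fieldType) (V : vectType F) (br : V -> V -> V) (H0 : V).

Definition split_abelian (a : {vspace V}) : Prop :=
  (forall H H', H \in a -> H' \in a -> br H H' = 0) /\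
  (forall H, H \in a -> diagonalizable_end (ad br H)).

Definition maximal_split_abelian (a : {vspace V}) : Prop :=
  [/\ (a <= g0 br H0)%VS, split_abelian a
    & forall b : {vspace V}, (b <= g0 br H0)%VS -> split_abelian b ->
        (a <= b)%VS -> b = a].

Definition linform (a : {vspace V}) := 'Hom(subvs_of a, F^o).

Variable a : {vspace V}.
Implicit Types (al be : linform a) (Pi : seq (linform a)).

(* Meaningful only for H \in a. *)
Definition rval al (H : V) : F := al (vsproj a H).

Definition in_root_space al (X : V) : Prop :=
  forall H, H \in a -> br H X = rval al H *: X.

Definition is_root al : Prop :=
  al != 0 /\ exists2 X, X != 0 & in_root_space al X.

(* be |-> be - be(H) al is the reflection attached to al.  H is unique as
   soon as the roots span the space of linear forms on a, in particular when br is simple. *)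
Definition is_coroot al (H : V) : Prop :=
  [/\ H \in a, rval al H = 2%:R
    & forall be, is_root be -> is_root (be - rval be H *: al)].

Definition strongly_orthogonal al be : Prop :=
  [/\ ~ is_root (al + be), ~ is_root (al - be), al + be <> 0 & al - be <> 0].

Definition nonneg_comb Pi al : Prop :=
  exists c : linform a -> nat, al = \sum_(be <- Pi) be *+ c be.

Definition is_base (S : linform a -> Prop) Pi : Prop :=
  [/\ free Pi, (forall al, al \in Pi -> S al)
    & forall al, S al -> nonneg_comb Pi al \/ nonneg_comb Pi (- al)].

Definition positive_root Pi al : Prop := is_root al /\ nonneg_comb Pi al.

(* al belongs to the base of S whose positive roots are S :&: Pos. *)
Definition simple_in (S Pos : linform a -> Prop) al : Prop :=
  exists Pi, [/\ is_base S Pi,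
    (forall be, S be -> (nonneg_comb Pi be <-> Pos be)) & al \in Pi].

Variables (Pi : seq (linform a)) (k : nat) (lam : 'I_k.+1 -> linform a).

Definition descent_roots (j : nat) al : Prop :=
  is_root al /\ forall i : 'I_k.+1, (i < j)%N -> strongly_orthogonal al (lam i).

(* The descent stops exactly at lam_k; for j = 0, descent_roots 0 is the whole
   root system and simple_in refers to Pi itself. *)
Definition is_descent : Prop :=
  (forall j : 'I_k.+1,
     unique (fun al => simple_in (descent_roots j) (positive_root Pi) al /\
                       rval al H0 = 2%:R) (lam j)) /\
  ~ (exists al, descent_roots k.+1 al /\ rval al H0 = 2%:R).

End Roots.

Section Groups.
Variables (F : fieldType) (Fbar : fieldType) (iota : {rmorphism F -> Fbar}).
Variables (V : vectType F) (br : V -> V -> V) (H0 : V).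
Variables (k : nat) (Hl : 'I_k.+1 -> V).

Definition a0 : {vspace V} := (\sum_(j < k.+1) <[Hl j]>)%VS.

Definition Espace (i j : 'I_k.+1) (p q : F) : {vspace V} :=
  (eigenspace_ad br (Hl i) p :&: eigenspace_ad br (Hl j) q :&:
   \bigcap_(s < k.+1 | (s != i) && (s != j)) eigenspace_ad br (Hl s) 0)%VS.

Definition nspace : {vspace V} :=
  (\sum_(i < k.+1) \sum_(j < k.+1 | (i < j)%N) Espace i j 1 (- 1))%VS.

Definition Gtilde : 'End(V) -> Prop := Aut0 iota br.
Definition Ggrp (g : 'End(V)) : Prop := Gtilde g /\ g H0 = H0.
Definition Lgrp (g : 'End(V)) : Prop := Ggrp g /\ forall H, H \in a0 -> g H = H.
Definition Ngrp (g : 'End(V)) : Prop := exists2 X, X \in nspace & g = exp_ad br X.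
Definition Pgrp (g : 'End(V)) : Prop :=
  exists l u, [/\ Lgrp l, Ngrp u & g = (l \o u)%VF].

Definition ad_a0 (f : 'End(V)) : Prop := exists2 H, H \in a0 & f = ad br H.

(* T is the group of F-points of a split torus of GL(V), i.e. of the image of
   a closed embedding of G_m^r: this is t |-> diag(prod_j t_j^(m i j))_i in
   some basis b of V, where the weights (the rows of m) generate Z^r.  Its Lie
   algebra is the image h of the differential. *)
Definition split_torus_with_Lie (T h : 'End(V) -> Prop) : Prop :=
  exists (b : (\dim {:V}).-tuple V) (r : nat) (m : 'M[int]_(\dim {:V}, r)),
  [/\ basis_of fullv b,
      (forall c : 'rV[int]_r, exists d : 'rV[int]_(\dim {:V}), c = d *m m),
      (forall f, T f <-> exists t : 'I_r -> F, (forall j, t j != 0) /\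
         forall i, f (tnth b i) = (\prod_(j < r) t j ^ m i j) *: tnth b i)
    & (forall f, h f <-> exists x : 'I_r -> F,
         forall i, f (tnth b i) = (\sum_(j < r) x j *~ m i j) *: tnth b i)].

Definition split_torus_of_G (A : 'End(V) -> Prop) : Prop :=
  (forall f, A f -> Ggrp f) /\ split_torus_with_Lie A ad_a0.

Definition normalizes_group (c : 'End(V)) (S : 'End(V) -> Prop) : Prop :=
  forall f, S f <-> S (c \o f \o c^-1)%VF.

Definition normalizer_a0 (c : 'End(V)) : Prop := Gtilde c /\ (c @: a0)%VS = a0.

(* X j, Y j are the components of I^+, I^-; Hl j is the coroot of lam j. *)
Definition diagonal_triple (a : {vspace V}) (lam : 'I_k.+1 -> linform a)
    (X Y : 'I_k.+1 -> V) : Prop :=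
  sl2_triple br (\sum_j Y j) H0 (\sum_j X j) /\
  forall j, [/\ in_root_space br (lam j) (X j), X j != 0,
                in_root_space br (- lam j) (Y j), Y j != 0
              & sl2_triple br (Y j) (Hl j) (X j)].

Definition gamma_data (x y : 'I_k.+1 -> 'I_k.+1 -> V) : Prop :=
  forall i j, i != j ->
    [/\ x i j \in Espace i j 1 (- 1), y i j \in Espace i j (- 1) 1
      & sl2_triple br (y i j) (Hl i - Hl j) (x i j)].

Definition gamma_ij (x y : 'I_k.+1 -> 'I_k.+1 -> V) (i j : 'I_k.+1) : 'End(V) :=
  (exp_ad br (x i j) \o exp_ad br (y i j) \o exp_ad br (x i j))%VF.

(* rev_ord j has value k - j. *)
Definition involution_of (X Y : 'I_k.+1 -> V) (c : 'End(V)) : Prop :=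
  [/\ normalizer_a0 c,
      (forall j, c (Hl j) = - Hl (rev_ord j)),
      (forall j, c (X j) = Y (rev_ord j))
    & (c \o c)%VF = \1%VF].

End Groups.

(* Main.v *)
(* The Weyl element w = exp(ad I+) exp(ad I-) exp(ad I+) maps X_j to Y_j and H_j
   to - H_j, and w^2 = 1 because ad H_0 has only even weights.  It remains to
   compose it with an involution tau which commutes with w and realises
   j |-> k - j on the X_j and the H_j.

   For a pair i < k - i, gamma_{i,k-i} exchanges X_i and X_{k-i}, but its square
   is (-1)^(H_i - H_{k-i}), which need not be 1.  Let w_i be the Weyl element of
   (Y_i, H_i, X_i), so that w_i^2 = (-1)^{H_i}.  Then s_i = gamma_{i,k-i} w_i^2
   acts on the X_j and the H_j as gamma_{i,k-i} does, and squares to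
   (-1)^(H_i - H_{k-i} + H_i + H_{k-i}) = 1.  The s_i commute, tau is their
   product, and tau commutes with w because it fixes I+, H_0, hence I-.

   All nilpotent elements used satisfy (ad x)^3 = 0, so their exponentials are
   quadratic polynomials in ad x.  For the elements of E_{i,j}(1,-1) this follows
   from sl2-theory: on vectors of opposite weights (p, q) for (H_i, H_j) only
   (p, q) = +-(1,-1) occurs, as otherwise X_j or Y_j would lead out of the
   degrees -2, 0, 2 of ad H_0.

   The normaliser statements are formal except for A^0, where one needs that a
   split torus is determined by its Lie algebra (characteristic 0). *)

Require Import Defs.
From HB Require Import structures.
From mathcomp Require Import all_boot all_order all_algebra all_field.
From mathcomp Require Import zify ring.

Set Implicit Arguments.
Unset Strict Implicit.
Unset Printing Implicit Defensive.

Import Order.TTheory GRing.Theory Num.Theory.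
Local Open Scope ring_scope.

(** * Brackets and exponentials *)

Section CharZero.
Variables (F : fieldType) (char0 : [pchar F] =i pred0).

Lemma natr_neq0 n : n.+1%:R != 0 :> F.
Proof. by rewrite (pcharf0P F).1. Qed.

Lemma intr_inj0 : injective (intr : int -> F).
Proof.
move=> a b /eqP; rewrite -subr_eq0 -rmorphB /= => /eqP h.
apply/eqP; rewrite -subr_eq0; move: h; case: (a - b) => [[|n]|n] //.
  by rewrite -pmulrn => /eqP; rewrite (negPf (natr_neq0 n)).
rewrite NegzE mulrNz -pmulrn => /eqP; rewrite oppr_eq0.
by rewrite (negPf (natr_neq0 n)).
Qed.

End CharZero.

Section Vectors.
Variables (F : fieldType) (V : vectType F).

Lemma coord_ext (u v : V) :
  (forall i, coord (vbasis {:V}) i u = coord (vbasis {:V}) i v) -> u = v.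
Proof.
move=> e; rewrite (coord_vbasis (memvf u)) (coord_vbasis (memvf v)).
by apply: eq_bigr => i _; rewrite e.
Qed.

End Vectors.

(* Turns an identity of linear combinations into identities of scalars. *)
Ltac vec := apply: coord_ext => ?; rewrite ?(linearD, linearB, linearN, linearZ, linear0) /=.

Section Lie.
Variables (F : fieldType) (char0 : [pchar F] =i pred0).
Variables (V : vectType F) (br : V -> V -> V) (hbr : lie_bracket br).

(** [linfun] returns the given function only when it is linear, so the linearity of [br x] is first
    packed as a structure. *)
Lemma adE x v : ad br x v = br x v.
Proof.
pose m := GRing.isLinear.Build F V V *:%R (br x) (lie_linearr hbr x).
pose f : {linear V -> V} := HB.pack (br x) m.
by rewrite /ad -[br x]/(f : V -> V) lfunE.
Qed.

Lemma brC x y : br x y = - br y x.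
Proof.
have bD1 u v w : br (u + v) w = br u w + br v w.
  by have := lie_linearl hbr w 1 u v; rewrite !scale1r.
have bD2 u v w : br u (v + w) = br u v + br u w.
  by have := lie_linearr hbr u 1 v w; rewrite !scale1r.
have := lie_alt hbr (x + y); rewrite bD1 !bD2 !(lie_alt hbr) add0r addr0.
by move/eqP; rewrite addr_eq0 => /eqP.
Qed.

Lemma brDr x u v : br x (u + v) = br x u + br x v.
Proof. by rewrite -!adE linearD. Qed.
Lemma brNr x u : br x (- u) = - br x u.
Proof. by rewrite -!adE linearN. Qed.
Lemma brBr x u v : br x (u - v) = br x u - br x v.
Proof. by rewrite brDr brNr. Qed.
Lemma brZr x a u : br x (a *: u) = a *: br x u.
Proof. by rewrite -!adE linearZ. Qed.
Lemma br0r x : br x 0 = 0.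
Proof. by rewrite -adE linear0. Qed.
Lemma brDl x u v : br (u + v) x = br u x + br v x.
Proof. by rewrite ![br _ x]brC brDr opprD. Qed.
Lemma brNl x u : br (- u) x = - br u x.
Proof. by rewrite ![br _ x]brC brNr. Qed.
Lemma brBl x u v : br (u - v) x = br u x - br v x.
Proof. by rewrite brDl brNl. Qed.
Lemma brZl x a u : br (a *: u) x = a *: br u x.
Proof. by rewrite ![br _ x]brC brZr scalerN. Qed.
Lemma br0l x : br 0 x = 0.
Proof. by rewrite brC br0r oppr0. Qed.
Lemma br_sumr I (r : seq I) (P : pred I) (E : I -> V) x :
  br x (\sum_(i <- r | P i) E i) = \sum_(i <- r | P i) br x (E i).
Proof. by rewrite -adE linear_sum; apply: eq_bigr => i _; exact: adE. Qed.
Lemma br_suml I (r : seq I) (P : pred I) (E : I -> V) x :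
  br (\sum_(i <- r | P i) E i) x = \sum_(i <- r | P i) br (E i) x.
Proof. by rewrite brC br_sumr -sumrN; apply: eq_bigr => i _; rewrite -brC. Qed.

Lemma brA x u v : br x (br u v) = br (br x u) v + br u (br x v).
Proof.
have := lie_jacobi hbr x u v.
rewrite [br v (br x u)]brC [br v x]brC brNr => /eqP.
by rewrite -addrA addr_eq0 opprD !opprK addrC => /eqP.
Qed.

(** Weights are integers read in [F]: in characteristic 0, comparing weights becomes integer
    arithmetic. *)
Definition wt (H : V) (z : int) (v : V) : Prop := br H v = z%:~R *: v.

Lemma wt_br H a b u v : wt H a u -> wt H b v -> wt H (a + b) (br u v).
Proof. by rewrite /wt brA => -> ->; rewrite brZl brZr -scalerDl intrD. Qed.

Lemma wt_uniq H a b v : wt H a v -> wt H b v -> a != b -> v = 0.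
Proof.
rewrite /wt => -> /eqP; rewrite -subr_eq0 -scalerBl scaler_eq0 subr_eq0.
by case/orP => [/eqP/(intr_inj0 char0) -> /eqP|/eqP].
Qed.

Lemma wtZ H z c u : wt H z u -> wt H z (c *: u).
Proof. by rewrite /wt brZr => ->; rewrite !scalerA mulrC. Qed.

Definition ad_cube0 (x : V) : Prop := forall v, br x (br x (br x v)) = 0.

Hypothesis dimV : (1 < \dim {:V})%N.

(** [exp_nilp] sums the powers up to the exponent [\dim {:V}], so dimension at least 2 guarantees
    that the quadratic term is present. *)
Lemma exp_adE x v : ad_cube0 x ->
  exp_ad br x v = v + br x v + 2%:R^-1 *: br x (br x v).
Proof.
move=> hx; rewrite /exp_ad /exp_nilp sum_lfunE.
case: (\dim _) dimV => [|[|n]] // _.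
rewrite 3!big_ord_recl big1 => [|i _] /=; last first.
  by rewrite !lfunE /= !lfunE /= !lfunE /= !lfunE /= !adE hx scaler0.
rewrite !lfunE /= !lfunE /= ?lfunE /= !lfunE /= ?lfunE /= !adE.
by rewrite addr0 addrA !fact0 /= !invr1 !scale1r.
Qed.

(** By the Leibniz rule, the bracket of the two exponentials and the exponential of [br u v] differ
    by terms of degree 3 and 4 in [x]. These are rational multiples of the third and fourth
    derivatives of [br u v], which vanish. *)
Lemma exp_ad_aut x : ad_cube0 x -> lie_automorphism br (exp_ad br x).
Proof.
move=> hx; split; last first.
  move=> u v; rewrite !exp_adE //.
  have h3 := hx (br u v); have h4 : br x (br x (br x (br x (br u v)))) = 0.
    by rewrite (hx (br u v)) br0r.
  set u1 := br x u; set u2 := br x u1; set v1 := br x v; set v2 := br x v1.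
  have [hu hv] : br x u2 = 0 /\ br x v2 = 0 by split; exact: hx.
  have e00 : br x (br u v) = br u1 v + br u v1 := brA x u v.
  have e10 : br x (br u1 v) = br u2 v + br u1 v1 := brA x u1 v.
  have e01 : br x (br u v1) = br u1 v1 + br u v2 := brA x u v1.
  have e11 : br x (br u1 v1) = br u2 v1 + br u1 v2 := brA x u1 v1.
  have e20 : br x (br u2 v) = br u2 v1 by rewrite brA hu br0l add0r.
  have e02 : br x (br u v2) = br u1 v2 by rewrite brA hv br0r addr0.
  have e21 : br x (br u2 v1) = br u2 v2 by rewrite brA hu br0l add0r.
  have e12 : br x (br u1 v2) = br u2 v2 by rewrite brA hv br0r addr0.
  move: h3 h4; rewrite !(e00, e10, e01, e11, e20, e02, e21, e12, brDr x) => h3 h4.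
  rewrite !(brDl, brDr, brZl, brZr).
  set D2 := br u2 v2 in h4 *; set D12 := br u1 v2 in h3 *; set D21 := br u2 v1 in h3 *.
  have two := natr_neq0 char0 1; have three := natr_neq0 char0 2.
  have D2_0 : D2 = 0.
    have: (2%:R * 3%:R) *: D2 = 0 by rewrite -[RHS]h4; vec; ring.
    by move/eqP; rewrite scaler_eq0 mulf_eq0 (negPf two) (negPf three) => /eqP.
  have D3_0 : D21 = - D12.
    apply/eqP; rewrite -addr_eq0.
    have: 3%:R *: (D21 + D12) = 0 by rewrite -[RHS]h3; vec; ring.
    by move/eqP; rewrite scaler_eq0 (negPf three).
  rewrite D2_0 D3_0.
  by vec; field.
(* Injectivity: applying [br x] twice, then once, to the vanishing of the exponential kills the
   quadratic and the linear term in turn. *)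
apply/eqP; rewrite -subv0; apply/subvP => v; rewrite memv_ker exp_adE // memv0.
move/eqP => h; have h2 : br x (br x v) = 0.
  have := congr1 (br x) (congr1 (br x) h).
  by rewrite !(brDr, brZr, hx, br0r, scaler0, addr0).
have h1 : br x v = 0.
  by have := congr1 (br x) h; rewrite !(brDr, brZr, hx, h2, br0r, scaler0, addr0).
by move: h; rewrite h1 !(br0r, scaler0, addr0) => ->.
Qed.

Lemma exp_ad_fix x v : ad_cube0 x -> br x v = 0 -> exp_ad br x v = v.
Proof. by move=> hx h; rewrite exp_adE // h br0r scaler0 !addr0. Qed.

(** The same fold as in [elementary]: the product is elementary as soon as its letters are
    ad-nilpotent. *)
Definition exp_prod (s : seq V) : 'End(V) :=
  foldr (fun x h => (exp_ad br x \o h)%VF) \1%VF s.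

Lemma exp_prod_cat s t : exp_prod (s ++ t) = (exp_prod s \o exp_prod t)%VF.
Proof. by elim: s => [|x s /= ->]; rewrite /= ?comp_lfun1l // comp_lfunA. Qed.

Lemma lie_aut1 : lie_automorphism br \1%VF.
Proof.
split=> [|u v]; last by rewrite !lfunE.
by apply/eqP; rewrite -subv0; apply/subvP => v; rewrite memv_ker lfunE memv0.
Qed.

Lemma lie_aut_comp g h : lie_automorphism br g -> lie_automorphism br h ->
  lie_automorphism br (g \o h)%VF.
Proof.
move=> [/eqP g0 g1] [/eqP h0 h1]; split=> [|u v]; last by rewrite !lfunE /= h1 g1.
apply/eqP; rewrite -subv0; apply/subvP => v; rewrite memv_ker lfunE /= memv0.
have ker0 (f : 'End(V)) u : lker f == 0%VS -> f u == 0 -> u == 0.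
  by move=> /eqP f0; rewrite -memv_ker f0 memv0.
by move/(ker0 _ _ g0)/(ker0 _ _ h0).
Qed.

Lemma exp_prod_aut s : (forall x, x \in s -> ad_cube0 x) -> lie_automorphism br (exp_prod s).
Proof.
elim: s => [_|x s IH hs]; first exact: lie_aut1.
apply: lie_aut_comp; first by apply: exp_ad_aut; apply: hs; rewrite mem_head.
by apply: IH => y ys; apply: hs; rewrite inE ys orbT.
Qed.

Lemma exp_prod_fix s v : (forall x, x \in s -> ad_cube0 x /\ br x v = 0) ->
  exp_prod s v = v.
Proof.
elim: s => [_|x s IH hs] /=; first by rewrite lfunE.
rewrite lfunE /= IH => [|y ys]; last by apply: hs; rewrite inE ys orbT.
by have [hx h] := hs x (mem_head x s); rewrite exp_ad_fix.
Qed.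

Lemma iter_ad_conj (g : 'End(V)) x m : (forall u v, g (br u v) = br (g u) (g v)) ->
  (g \o iter_lfun m (ad br x))%VF = (iter_lfun m (ad br (g x)) \o g)%VF.
Proof.
move=> hg; elim: m => [|m IH]; rewrite /iter_lfun /=.
  by rewrite comp_lfun1l comp_lfun1r.
apply/lfunP => v; move/lfunP: IH => /(_ v); rewrite !lfunE /= !lfunE /= => IH.
by rewrite !adE hg IH.
Qed.

Lemma exp_ad_conj (g : 'End(V)) x : (forall u v, g (br u v) = br (g u) (g v)) ->
  (g \o exp_ad br x)%VF = (exp_ad br (g x) \o g)%VF.
Proof.
move=> hg; rewrite /exp_ad /exp_nilp; apply/lfunP => v.
rewrite !lfunE /= !sum_lfunE linear_sum; apply: eq_bigr => m _ /=.
rewrite !scale_lfunE linearZ /=.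
by have /lfunP/(_ v) := iter_ad_conj x m hg; rewrite !lfunE /= => ->.
Qed.

Lemma exp_prod_comm (g : 'End(V)) s : (forall u v, g (br u v) = br (g u) (g v)) ->
  (forall x, x \in s -> g x = x) -> (g \o exp_prod s)%VF = (exp_prod s \o g)%VF.
Proof.
move=> hg; elim: s => [_|x s IH hs] /=; first by rewrite comp_lfun1l comp_lfun1r.
rewrite comp_lfunA exp_ad_conj // hs ?mem_head // -!comp_lfunA IH // => y ys.
by apply: hs; rewrite inE ys orbT.
Qed.

End Lie.

(** * Weights of sl2-triples *)

Section SL2.
Variables (F : fieldType) (char0 : [pchar F] =i pred0).
Variables (V : vectType F) (br : V -> V -> V) (hbr : lie_bracket br).

Lemma sl2_sym Y H X : sl2_triple br Y H X -> sl2_triple br X (- H) Y.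
Proof.
move=> [hX hY hH]; split; rewrite ?(brNl hbr) ?hX ?hY ?opprK //.
by rewrite (brC hbr) hH.
Qed.

Lemma sl2_XY Y H X v : sl2_triple br Y H X -> br X (br Y v) = br Y (br X v) - br H v.
Proof. by case=> _ _ <-; rewrite (brA hbr Y X v) addrAC subrr add0r. Qed.

Lemma sl2_HY Y H X c v : sl2_triple br Y H X -> br H v = c *: v ->
  br H (br Y v) = (c - 2%:R) *: br Y v.
Proof.
by case=> _ hY _ hv; rewrite (brA hbr) hY hv (brNl hbr) (brZl hbr) (brZr hbr); vec; ring.
Qed.

Lemma sl2_HX Y H X c v : sl2_triple br Y H X -> br H v = c *: v ->
  br H (br X v) = (c + 2%:R) *: br X v.
Proof.
by case=> hX _ _ hv; rewrite (brA hbr) hX hv (brZl hbr) (brZr hbr); vec; ring.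
Qed.

(** For [v] killed by [X] one has [X Y^m v = - m (c - m + 1) Y^(m-1) v]. Since [Y^3 v = 0], a
    nonzero [v] forces one of the factors with [m <= 3] to vanish. *)
Lemma highest_weight Y H X c v : sl2_triple br Y H X -> ad_cube0 br Y ->
  br H v = c *: v -> br X v = 0 -> v = 0 \/ exists2 z : int, (0 <= z <= 2)%R & c = z%:~R.
Proof.
move=> tr Y3 hv Xv.
have XY := sl2_XY _ tr; have HY := sl2_HY tr.
have XY1 : br X (br Y v) = - c *: v by rewrite XY Xv hv (br0r hbr); vec; ring.
have XY2 : br X (br Y (br Y v)) = - (c * 2%:R - 2%:R) *: br Y v.
  by rewrite XY XY1 (HY _ _ hv) (brZr hbr); vec; ring.
have XY3 : br X (br Y (br Y (br Y v))) = - (c * 3%:R - 6%:R) *: br Y (br Y v).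
  by rewrite XY XY2 (HY _ _ (HY _ _ hv)) (brZr hbr); vec; ring.
have n2 := natr_neq0 char0 1; have n3 := natr_neq0 char0 2.
have [c0|c0] := eqVneq c 0; first by right; exists 0.
have [c1|c1] := eqVneq c 1; first by right; exists 1.
have [c2|c2] := eqVneq c 2%:R; first by right; exists 2.
left; move: XY3; rewrite Y3 (br0r hbr) => /esym/eqP; rewrite scaler_eq0 oppr_eq0.
rewrite (_ : c * 3%:R - 6%:R = (c - 2%:R) * 3%:R); last by ring.
rewrite mulf_eq0 subr_eq0 (negPf c2) (negPf n3) /= => /eqP Y2.
move: XY2; rewrite Y2 (br0r hbr) => /esym/eqP; rewrite scaler_eq0 oppr_eq0.
rewrite (_ : c * 2%:R - 2%:R = (c - 1) * 2%:R); last by ring.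
rewrite mulf_eq0 subr_eq0 (negPf c1) (negPf n2) /= => /eqP Y1.
move: XY1; rewrite Y1 (br0r hbr) => /esym/eqP; rewrite scaler_eq0 oppr_eq0.
by rewrite (negPf c0) /= => /eqP.
Qed.

(** The last nonzero vector among [v], [X v], [X X v] is a highest weight vector, of weight [c],
    [c + 2] or [c + 4]. *)
Lemma weight_bound_low Y H X c v : sl2_triple br Y H X -> ad_cube0 br X -> ad_cube0 br Y ->
  br H v = c *: v -> v = 0 \/ exists2 z : int, (-4 <= z <= 2)%R & c = z%:~R.
Proof.
move=> tr X3 Y3 hv; have hw := highest_weight tr Y3; have HX := sl2_HX tr.
have [/hw|] := eqVneq (br X (br X v)) 0; last first.
  have h2 := HX _ _ (HX _ _ hv) => ne.
  case: (hw _ _ h2 (X3 _)) => [/eqP|[z zb e]]; first by rewrite (negPf ne).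
  right; exists (z - 4); first lia.
  by rewrite rmorphB /= -e; ring.
move=> /(_ _ (HX _ _ hv)) [Xv|[z zb e]].
  by case: (hw _ _ hv Xv) => [->|[z zb ->]]; [left | right; exists z; first lia].
right; exists (z - 2); first lia.
by rewrite rmorphB /= -e; ring.
Qed.

(** The missing lower bound is the upper bound for the opposite triple [(X, -H, Y)]. *)
Lemma weight_bound Y H X c v : sl2_triple br Y H X -> ad_cube0 br X -> ad_cube0 br Y ->
  br H v = c *: v -> v = 0 \/ exists2 z : int, (`|z| <= 2)%R & c = z%:~R.
Proof.
move=> tr X3 Y3 hv; case: (weight_bound_low tr X3 Y3 hv) => [|[z zb e]]; first by left.
have hv' : br (- H) v = (- c) *: v by rewrite (brNl hbr) hv scaleNr.
case: (weight_bound_low (sl2_sym tr) Y3 X3 hv') => [|[t tb e']]; first by left.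
right; exists z => //; suff : z = - t by lia.
by apply: (intr_inj0 char0); rewrite -e rmorphN /= -e' opprK.
Qed.

Lemma wt_bound Y H X z v : sl2_triple br Y H X -> ad_cube0 br X -> ad_cube0 br Y ->
  wt br H z v -> v = 0 \/ `|z| <= 2.
Proof.
move=> tr X3 Y3 hv; case: (weight_bound tr X3 Y3 hv) => [|[t tb e]]; [by left|right].
by rewrite (intr_inj0 char0 e).
Qed.

Lemma lowering_inj Y H X z v : sl2_triple br Y H X -> ad_cube0 br Y ->
  wt br H z v -> z < 0 -> br X v = 0 -> v = 0.
Proof.
move=> tr Y3 hv z0 Xv; case: (highest_weight tr Y3 hv Xv) => // [[t tb e]].
by have := intr_inj0 char0 e; lia.
Qed.

Hypothesis dimV : (1 < \dim {:V})%N.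

Definition weyl (Y X : V) : 'End(V) := exp_prod br [:: X; Y; X].

Lemma weylE Y X v : weyl Y X v = exp_ad br X (exp_ad br Y (exp_ad br X v)).
Proof. by rewrite /weyl /= !lfunE /= !lfunE /= !lfunE /= lfunE. Qed.

(** Applied with [X], [Y] the sums over all indices and [X'], [H'], [Y'] the triple of a single
    index; hence only the brackets between the two are prescribed. *)
Lemma weyl_X Y X Y' H' X' : ad_cube0 br X -> ad_cube0 br Y ->
  br X X' = 0 -> br Y X' = H' -> br Y H' = 2%:R *: Y' ->
  br X H' = - (2%:R *: X') -> br X Y' = - H' -> weyl Y X X' = Y'.
Proof.
move=> X3 Y3 e1 e2 e3 e4 e5; have n2 := natr_neq0 char0 1.
have E1 : exp_ad br X X' = X' by rewrite (exp_ad_fix hbr dimV).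
have E2 : exp_ad br Y X' = X' + H' + Y'.
  by rewrite (exp_adE hbr dimV) // e2 e3 scalerA mulVf // scale1r.
rewrite weylE E1 E2 (exp_adE hbr dimV) // !(brDr hbr) e1 e4 e5.
rewrite !(brNr hbr, brZr hbr, brDr hbr) e1 e4 (br0r hbr).
by vec; field.
Qed.

(** * The Weyl element of an [sl_2]-triple on weight vectors, and its square *)

Section Square.
Variables (Y H X : V) (tr : sl2_triple br Y H X) (X3 : ad_cube0 br X) (Y3 : ad_cube0 br Y).

Let XY v : br X (br Y v) = br Y (br X v) - br H v. Proof. exact: sl2_XY tr. Qed.
Let n2 := natr_neq0 char0 1.

Lemma wt_X z v : wt br H z v -> wt br H (z + 2) (br X v).
Proof. by rewrite /wt rmorphD /= => /(sl2_HX tr). Qed.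

Lemma wt_Y z v : wt br H z v -> wt br H (z - 2) (br Y v).
Proof. by rewrite /wt rmorphB /= => /(sl2_HY tr). Qed.

Lemma wt_big z v : wt br H z v -> 2 < `|z| -> v = 0.
Proof. by move=> hv hz; case: (wt_bound tr X3 Y3 hv) => //; lia. Qed.

(** On a vector of weight [z], all terms of the triple exponential of weight other than [-z] cancel;
    this and the next four lemmas record what is left for each [z]. *)
Lemma weyl_wt1 v : wt br H 1 v -> weyl Y X v = br Y v.
Proof.
move=> hv; have Xv := wt_big (wt_X hv) isT.
have YYv := wt_big (wt_Y (wt_Y hv)) isT.
have XYv : br X (br Y v) = - v by rewrite XY Xv (br0r hbr) hv sub0r scale1r.
rewrite weylE !(exp_adE hbr dimV) // !(Xv, YYv, XYv, brDr hbr, brZr hbr, br0r hbr, brNr hbr).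
by vec; ring.
Qed.

Lemma weyl_wtN1 v : wt br H (-1) v -> weyl Y X v = br X v.
Proof.
move=> hv; have Yv := wt_big (wt_Y hv) isT.
have XXv := wt_big (wt_X (wt_X hv)) isT.
have YXv : br Y (br X v) = - v.
  have := XY v; rewrite Yv (br0r hbr) hv => /esym/eqP.
  by rewrite subr_eq0 scaleN1r => /eqP.
rewrite weylE !(exp_adE hbr dimV) // !(Yv, XXv, YXv, brDr hbr, brZr hbr, br0r hbr, brNr hbr).
by vec; ring.
Qed.

Lemma weyl_wt2 v : wt br H 2 v -> weyl Y X v = 2%:R^-1 *: br Y (br Y v).
Proof.
move=> hv; have Xv := wt_big (wt_X hv) isT.
have XYv : br X (br Y v) = - 2%:R *: v by rewrite XY Xv (br0r hbr) hv sub0r -scaleNr.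
have XYYv : br X (br Y (br Y v)) = - 2%:R *: br Y v.
  by rewrite XY XYv (wt_Y hv) (brZr hbr) scale0r subr0.
have E1 : exp_ad br X v = v by rewrite (exp_ad_fix hbr dimV).
rewrite weylE E1 !(exp_adE hbr dimV) // !(brDr hbr, brZr hbr, Xv, XYv, XYYv, br0r hbr).
by vec; field.
Qed.

Lemma weyl_wtN2 v : wt br H (-2) v -> weyl Y X v = 2%:R^-1 *: br X (br X v).
Proof.
move=> hv; have Yv := wt_big (wt_Y hv) isT.
have YX u : br Y (br X u) = br X (br Y u) + br H u by rewrite XY subrK.
have YXv : br Y (br X v) = - 2%:R *: v by rewrite YX Yv (br0r hbr) hv add0r.
have YXXv : br Y (br X (br X v)) = - 2%:R *: br X v.
  by rewrite YX YXv (wt_X hv) (brZr hbr) scale0r addr0.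
have E1 : exp_ad br Y (exp_ad br X v) = 2%:R^-1 *: br X (br X v).
  rewrite !(exp_adE hbr dimV) // !(brDr hbr, brZr hbr, Yv, YXv, YXXv, br0r hbr).
  by vec; field.
by rewrite weylE E1 (exp_ad_fix hbr dimV) // (brZr hbr) X3 scaler0.
Qed.

Lemma weyl_wt0 v : wt br H 0 v -> weyl Y X v = v + br Y (br X v).
Proof.
move=> hv; have XXv := wt_big (wt_X (wt_X hv)) isT.
have YYv := wt_big (wt_Y (wt_Y hv)) isT.
have YX u : br Y (br X u) = br X (br Y u) + br H u by rewrite XY subrK.
have XYv : br Y (br X v) = br X (br Y v) by rewrite YX hv scale0r addr0.
have XXYv : br X (br X (br Y v)) = - 2%:R *: br X v.
  by rewrite -XYv XY XXv (br0r hbr) (wt_X hv) sub0r -scaleNr.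
have YXYv : br Y (br X (br Y v)) = - 2%:R *: br Y v.
  by rewrite YX YYv (br0r hbr) (wt_Y hv) add0r.
rewrite weylE !(exp_adE hbr dimV) // !(brDr hbr, brZr hbr, XXv, XYv, YYv, XXYv, YXYv, br0r hbr).
by vec; field.
Qed.

(** As weights are bounded by 2, it suffices to compose the explicit formulas for the weights [z]
    and [-z]. *)
Lemma weyl_sq z v : wt br H z v -> weyl Y X (weyl Y X v) = (-1) ^ z *: v.
Proof.
move=> hv; have XY' u := XY u.
have YX u : br Y (br X u) = br X (br Y u) + br H u by rewrite XY subrK.
case: (wt_bound tr X3 Y3 hv) => [->|hz]; first by rewrite !linear0.
have : [\/ z = 0, z = 1, z = -1 | z = 2 \/ z = -2].
  have : (z = 0) \/ (z = 1) \/ (z = -1) \/ (z = 2) \/ (z = -2) by lia.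
  by case=> [|[|[|]]] h; [constructor 1|constructor 2|constructor 3|constructor 4].
case=> [e|e|e|[e|e]]; subst z.
- rewrite (weyl_wt0 hv) linearD /= (weyl_wt0 hv) weyl_wt0; last exact: wt_Y (wt_X hv).
  rewrite (XY' (br X v)) (wt_big (wt_X (wt_X hv))) // (wt_X hv) (br0r hbr) sub0r.
  by rewrite (brNr hbr) (brZr hbr) expr0z; vec; ring.
- rewrite (weyl_wt1 hv) (weyl_wtN1 (wt_Y hv)) XY' (wt_big (wt_X hv)) // (br0r hbr) hv.
  by rewrite sub0r expr1z scale1r scaleN1r.
- rewrite (weyl_wtN1 hv) (weyl_wt1 (wt_X hv)) YX (wt_big (wt_Y hv)) // (br0r hbr) hv.
  by rewrite add0r exprN1 invrN1 mulrN1z.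
- rewrite (weyl_wt2 hv) linearZ /= (weyl_wtN2 (wt_Y (wt_Y hv))).
  rewrite (XY' (br Y v)) (XY' v) (wt_big (wt_X hv)) // (wt_Y hv) hv.
  rewrite !(br0r hbr, brBr hbr, brZr hbr, sub0r, brNr hbr, scale0r, subr0) XY'.
  rewrite (wt_big (wt_X hv)) // hv (br0r hbr).
  by vec; rewrite -exprnP; field.
rewrite (weyl_wtN2 hv) linearZ /= (weyl_wt2 (wt_X (wt_X hv))).
rewrite (YX (br X v)) (YX v) (wt_big (wt_Y hv)) // (wt_X hv) hv.
rewrite !(br0r hbr, brDr hbr, brZr hbr, add0r, brNr hbr, scale0r, addr0) YX.
rewrite (wt_big (wt_Y hv)) // hv (br0r hbr).
have -> : (-1 : F) ^ (- 2 : int) = 1 by rewrite -[LHS]/(((-1) ^+ 2)^-1) sqrrN expr1n invr1.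
by vec; field.
Qed.

End Square.
End SL2.

(** * Joint eigenvectors *)

Section JointEigenvectors.
Variables (F : fieldType) (V : vectType F).
Implicit Types (f g : 'End(V)) (U : {vspace V}) (cs : seq F).

Lemma mem_eigen f c v : (v \in lker (f - c *: \1%VF)) = (f v == c *: v).
Proof. by rewrite memv_ker !lfunE /= !lfunE /= lfunE /= lfunE subr_eq0. Qed.

(** The product of the operators [f - c], for [c] in [cs], applied to [v]. *)
Definition eigen_product f cs v := foldr (fun c w => f w - c *: w) v cs.

Lemma eigen_product_comm f cs c v :
  eigen_product f cs (f v - c *: v) = f (eigen_product f cs v) - c *: eigen_product f cs v.
Proof.
by elim: cs => //= d cs ->; vec; ring.
Qed.

Lemma eigen_product_sum f cs I (r : seq I) (P : pred I) (E : I -> V) :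
  eigen_product f cs (\sum_(i <- r | P i) E i) = \sum_(i <- r | P i) eigen_product f cs (E i).
Proof.
elim: cs => //= c cs ->; rewrite linear_sum scaler_sumr -sumrB.
by apply: eq_bigr.
Qed.

Lemma eigen_product_eigen f cs c v : f v = c *: v -> c \in cs -> eigen_product f cs v = 0.
Proof.
move=> fv; elim: cs => //= d cs IH; rewrite inE => /predU1P[<-|/IH ->].
  by rewrite -eigen_product_comm fv subrr; elim: cs {IH} => //= d' cs ->;
    rewrite linear0 scaler0 subr0.
by rewrite linear0 scaler0 subr0.
Qed.

(** The list consists of the eigenvalues on an eigenbasis. Removing repetitions later allows
    division by their differences. *)
Lemma diagonalizable_eigen_product f : diagonalizable_end f ->
  exists2 cs, uniq cs & forall v, eigen_product f cs v = 0.
Proof.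
case=> b bV fb.
have [cs csb] : exists cs, forall v, v \in b -> exists2 c, c \in cs & f v = c *: v.
  elim: b {bV} fb => [|u b IH] fb; first by exists [::].
  have [|cs csb] := IH; first by move=> v vb; apply: fb; rewrite inE vb orbT.
  have [c fu] := fb u (mem_head _ _); exists (c :: cs) => v.
  rewrite inE => /predU1P[->|/csb[d dcs ?]]; first by exists c; rewrite ?mem_head.
  by exists d; rewrite // inE dcs orbT.
exists (undup cs) => [|v]; first exact: undup_uniq.
have kill_b u : u \in b -> eigen_product f (undup cs) u = 0.
  by move=> /csb[c cin fu]; apply: (eigen_product_eigen fu); rewrite mem_undup.
have killZ c u : eigen_product f (undup cs) (c *: u) = c *: eigen_product f (undup cs) u.
  elim: (undup cs) => //= d ds ->; rewrite linearZ /=; vec.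
  by ring.
have vb : v \in <<in_tuple b>>%VS by rewrite (span_basis bV) memvf.
rewrite (coord_span vb) eigen_product_sum big1 // => i _.
by rewrite killZ kill_b ?scaler0 // mem_nth.
Qed.

(* With w := (f - c) v = \sum_u u, u an eigenvector for c_u != c, the vector
   v - \sum_u (c_u - c)^-1 u lies in the c-eigenspace. *)
Lemma eigen_split f U cs v : (forall u, u \in U -> f u \in U) -> uniq cs ->
    v \in U -> eigen_product f cs v = 0 ->
  exists2 vs : seq V, v = \sum_(u <- vs) u &
    forall u, u \in vs -> u \in U /\ exists2 c, c \in cs & f u = c *: u.
Proof.
move=> fU; elim: cs v => [|c cs IH] v /=.
  by move=> _ _ ->; exists [::]; rewrite ?big_nil.
move=> /andP[cN cs_uniq] vU; rewrite -eigen_product_comm => kv.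
have [|vs e hvs] := IH _ cs_uniq _ kv; first by rewrite rpredB ?rpredZ ?fU.
have [ws ws_U [ws_sum ws_f]] : exists2 ws : seq V,
    (forall u, u \in ws -> u \in U /\ exists2 d, d \in cs & f u = d *: u) &
    \sum_(u <- vs) u = f (\sum_(u <- ws) u) - c *: (\sum_(u <- ws) u) /\ True.
  elim: vs {e} hvs => [|u vs IHv] hvs.
    by exists [::]; rewrite ?big_nil // linear0 scaler0 subr0.
  have [|ws hws [e _]] := IHv; first by move=> w wv; apply: hvs; rewrite inE wv orbT.
  have [uU [d dcs fu]] := hvs u (mem_head _ _).
  exists ((d - c)^-1 *: u :: ws).
    move=> w; rewrite inE => /predU1P[->|/hws//]; split; first by rewrite rpredZ.
    by exists d => //; rewrite linearZ /= fu !scalerA mulrC.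
  have E a s : f (a *: u + s) = a *: (d *: u) + f s by rewrite linearD linearZ /= fu.
  split=> //; rewrite !big_cons e E; vec.
  have dc : d - c != 0 by rewrite subr_eq0; apply: contraNneq cN => <-.
  by field.
exists (v - \sum_(u <- ws) u :: ws); first by rewrite big_cons subrK.
move=> u; rewrite inE => /predU1P[->|/ws_U[uU [d dcs fu]]]; last first.
  by split=> //; exists d; rewrite // inE dcs orbT.
split; first by rewrite rpredB // big_seq rpred_sum // => w /ws_U[].
exists c; rewrite ?mem_head //; apply/eqP; rewrite -subr_eq0; apply/eqP.
set S := \sum_(u <- ws) u in ws_sum *.
have -> : f (v - S) - c *: (v - S) = (f v - c *: v) - (f S - c *: S) by vec; ring.
by rewrite e ws_sum subrr.
Qed.

(** Commuting diagonalizable operators are simultaneously diagonalizable; as an induction principle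
    this reduces additive properties to joint eigenvectors. *)
Lemma joint_eigen_ind (fs : seq 'End(V)) (P : V -> Prop) :
    (forall f, f \in fs -> diagonalizable_end f) ->
    (forall f g, f \in fs -> g \in fs -> forall v, f (g v) = g (f v)) ->
    P 0 -> (forall u v, P u -> P v -> P (u + v)) ->
    (forall v, (forall f, f \in fs -> exists c, f v = c *: v) -> P v) ->
  forall v, P v.
Proof.
move=> dfs cfs P0 PD Pe v.
(* Generalised to stable subspaces: by commutation, an eigenspace of the first operator is stable
   under the others, so the induction can restrict to it. *)
suff: forall U, (forall f, f \in fs -> forall u, u \in U -> f u \in U) ->
    (forall u, u \in U -> (forall f, f \in fs -> exists c, f u = c *: u) -> P u) ->
    forall u, u \in U -> P u.
  by move/(_ fullv); apply=> [f _ u _|u _ /Pe|]; rewrite ?memvf.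
elim: fs dfs cfs {Pe} => [|f fs IH] dfs cfs U Us PU u uU; first exact: PU.
have [cs cs_uniq kf] := diagonalizable_eigen_product (dfs f (mem_head _ _)).
have [|vs -> vsU] := eigen_split _ cs_uniq uU (kf u).
  by move=> w wU; apply: Us; rewrite ?mem_head.
have : forall w, w \in vs -> P w.
  move=> w /vsU[wU [c _ fw]].
  apply: (IH _ _ (U :&: lker (f - c *: \1%VF))%VS).
  - by move=> g gfs; apply: dfs; rewrite inE gfs orbT.
  - by move=> g h gfs hfs; apply: cfs; rewrite inE (gfs, hfs) orbT.
  - move=> g gfs z; rewrite !memv_cap !mem_eigen => /andP[zU /eqP fz].
    rewrite Us ?inE ?gfs ?orbT //= (cfs f g) ?mem_head ?inE ?gfs ?orbT //.
    by rewrite fz linearZ.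
  - move=> z; rewrite memv_cap mem_eigen => /andP[zU /eqP fz] hz.
    by apply: PU => // g; rewrite inE => /predU1P[->|/hz//]; exists c.
  - by rewrite memv_cap wU mem_eigen fw eqxx.
elim: vs {vsU} => [|w vs IHv] hvs; first by rewrite big_nil.
rewrite big_cons; apply: PD; first by apply: hvs; rewrite mem_head.
by apply: IHv => z zv; apply: hvs; rewrite inE zv orbT.
Qed.

End JointEigenvectors.

(** * Construction of the involution *)

Section Diagonal.
Variables (F : fieldType) (char0 : [pchar F] =i pred0).
Variables (V : vectType F) (br : V -> V -> V) (hbr : lie_bracket br).
Hypothesis dimV : (1 < \dim {:V})%N.
Variables (H0 : V) (k : nat) (Hl X Y : 'I_k.+1 -> V).

Hypothesis grading : forall v, exists vm v0 vp,
  [/\ v = vm + v0 + vp, wt br H0 (-2) vm, wt br H0 0 v0 & wt br H0 2 vp].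
Hypothesis triple : forall j, sl2_triple br (Y j) (Hl j) (X j).
Hypothesis degX : forall j, wt br H0 2 (X j).
Hypothesis degY : forall j, wt br H0 (-2) (Y j).
Hypothesis XY0 : forall i j, i != j -> br (X i) (Y j) = 0.
Hypothesis H0E : H0 = \sum_j Hl j.
Hypothesis HlC : forall i j, br (Hl i) (Hl j) = 0.
Hypothesis Hl_diag : forall j, diagonalizable_end (ad br (Hl j)).
Hypothesis H0_diag : diagonalizable_end (ad br H0).

(** The grading makes [ad H0] a root of [t^3 - 4 t]. *)
Lemma deg_int c v : br H0 v = c *: v -> v = 0 \/
  exists2 z : int, z \in [:: -2; 0; 2] & c = z%:~R.
Proof.
move=> hv; pose K u := br H0 (br H0 (br H0 u)) - 4%:R *: br H0 u.
have K0 : K v = 0.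
  have [vm [v0 [vp [-> hm h0 hp]]]] := grading v.
  rewrite /K !(brDr hbr) hm h0 hp !(brZr hbr) hm h0 hp !(brZr hbr) hm h0 hp.
  by vec; ring.
have : (c * (c - 2%:R) * (c + 2%:R)) *: v = 0.
  by rewrite -[RHS]K0 /K hv !(brZr hbr) hv !(brZr hbr) hv; vec; ring.
move/eqP; rewrite scaler_eq0 => /orP[|/eqP]; last by left.
rewrite !mulf_eq0 subr_eq0 addr_eq0 => /orP[/orP[]|] /eqP ->; right.
- by exists 0.
- by exists 2.
- by exists (-2).
Qed.

Lemma deg_vanish d v : wt br H0 d v -> [&& d != -2, d != 0 & d != 2] -> v = 0.
Proof.
move=> hv hd; case: (deg_int hv) => // [[z zs /(intr_inj0 char0) e]]; subst z.
by move: zs hd; rewrite !inE; case: eqP; case: eqP; case: eqP.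
Qed.

(** Three brackets raise the degree by 6, from at least -2 to at least 4, beyond the grading. *)
Lemma deg2_ad_cube0 x : wt br H0 2 x -> ad_cube0 br x.
Proof.
move=> hx v; have [vm [v0 [vp [-> hm h0 hp]]]] := grading v.
have up d u : wt br H0 d u -> -4 < d -> br x (br x (br x u)) = 0.
  move=> hu hd; apply: (@deg_vanish (2 + (2 + (2 + d)))); last lia.
  by do 3 (apply: (wt_br hbr) => //).
by rewrite !(brDr hbr) !(up _ _ hm, up _ _ h0, up _ _ hp) // !addr0.
Qed.

Lemma degN2_ad_cube0 x : wt br H0 (-2) x -> ad_cube0 br x.
Proof.
move=> hx v; have [vm [v0 [vp [-> hm h0 hp]]]] := grading v.
have up d u : wt br H0 d u -> d < 4 -> br x (br x (br x u)) = 0.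
  move=> hu hd; apply: (@deg_vanish (-2 + (-2 + (-2 + d)))); last lia.
  by do 3 (apply: (wt_br hbr) => //).
by rewrite !(brDr hbr) !(up _ _ hm, up _ _ h0, up _ _ hp) // !addr0.
Qed.

Let X3 j : ad_cube0 br (X j). Proof. exact/deg2_ad_cube0/degX. Qed.
Let Y3 j : ad_cube0 br (Y j). Proof. exact/degN2_ad_cube0/degY. Qed.

(** For [i != j], [X j] commutes with [Y i] by [XY0] and with [X i] for degree reasons, hence with
    [Hl i = [Y i, X i]]. *)
Lemma wt_Hl_X i j : wt br (Hl i) (if i == j then 2 else 0) (X j).
Proof.
have [<-|ij] := eqVneq i j; first by case: (triple i).
have [_ _ <-] := triple i; rewrite /wt scale0r.
have := brA hbr (Y i) (X i) (X j).
rewrite [br (Y i) (X j)](brC hbr) XY0 1?eq_sym // oppr0 (br0r hbr) addr0 => <-.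
rewrite (@deg_vanish (2 + 2) (br (X i) (X j))) ?(br0r hbr) //.
by apply: (wt_br hbr).
Qed.

Lemma wt_Hl_Y i j : wt br (Hl i) (if i == j then - 2 else 0) (Y j).
Proof.
have [<-|ij] := eqVneq i j.
  by have [_ e _] := triple i; rewrite /wt e rmorphN scaleNr.
have [_ _ <-] := triple i; rewrite /wt scale0r.
have := brA hbr (Y i) (X i) (Y j).
rewrite XY0 // (br0r hbr) (@deg_vanish (-2 + -2) (br (Y i) (Y j))) //.
  by rewrite (br0r hbr) addr0.
by apply: (wt_br hbr).
Qed.

Lemma raise_inj j z v : wt br (Hl j) z v -> z < 0 -> br (X j) v = 0 -> v = 0.
Proof. exact: lowering_inj (triple j) (@Y3 j). Qed.

Lemma lower_inj j z v : wt br (Hl j) z v -> 0 < z -> br (Y j) v = 0 -> v = 0.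
Proof.
move=> hv z0; apply: (lowering_inj char0 hbr (sl2_sym hbr (triple j)) (@X3 j)).
  by rewrite /wt (brNl hbr) hv -scaleNr -rmorphN.
by rewrite oppr_lt0.
Qed.

(** Bracketing with [X j] is injective on negative weights of [Hl j], yet here it would lead to
    degree 4. *)
Lemma vanish_deg2 j z u : wt br (Hl j) z u -> z < 0 -> wt br H0 2 u -> u = 0.
Proof.
move=> hz z0 hu; apply: (raise_inj hz z0); apply: (@deg_vanish (2 + 2)) => //.
by apply: (wt_br hbr).
Qed.

Lemma vanish_degN2 j z u : wt br (Hl j) z u -> 0 < z -> wt br H0 (-2) u -> u = 0.
Proof.
move=> hz z0 hu; apply: (lower_inj hz z0); apply: (@deg_vanish (-2 + -2)) => //.
by apply: (wt_br hbr).
Qed.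

(** Bracketing with [X i], injective since [a < 0], leads to degree 2 with the negative weight [b]
    for [Hl j], the case already excluded. *)
Lemma vanish_deg0 i j a b u : i != j -> wt br (Hl i) a u -> wt br (Hl j) b u ->
  a < 0 -> b < 0 -> wt br H0 0 u -> u = 0.
Proof.
move=> ij ha hb a0 b0 hu; apply: (raise_inj ha a0).
apply: (@vanish_deg2 j (0 + b)); rewrite ?add0r //.
  by rewrite -[b]add0r; apply: (wt_br hbr) => //; have := wt_Hl_X j i; rewrite eq_sym (negPf ij).
by rewrite -[2]addr0; apply: wt_br.
Qed.

Lemma weight_Hl j z v : wt br (Hl j) z v -> v = 0 \/ `|z| <= 2.
Proof. exact: wt_bound (triple j) (@X3 j) (@Y3 j). Qed.

(** Degrees 2 and -2 are excluded by the signs of [q] and [p]. In degree 0 with [p = 2], the Weyl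
    element of index [i] is half of [Y i] applied twice and lands in degree -4, although it is
    injective because its square is a sign. The case [q = -2] is symmetric. *)
Lemma opposite_weights i j p q d v : i != j -> wt br (Hl i) p v ->
  wt br (Hl j) q v -> wt br H0 d v -> 0 < p -> q < 0 -> v = 0 \/ p = 1 /\ q = -1.
Proof.
move=> ij hp hq hd p0 q0.
have sq l z u : wt br (Hl l) z u -> weyl br (Y l) (X l) u = 0 -> u = 0.
  move=> hu w0; have := weyl_sq char0 hbr dimV (triple l) (@X3 l) (@Y3 l) hu.
  rewrite w0 linear0 => /esym/eqP; rewrite scaler_eq0 => /orP[|/eqP//].
  by rewrite expfz_eq0 oppr_eq0 oner_eq0 andbF.
have [->|vN0] := eqVneq v 0; [by left|right].
case: (weight_Hl hp) => [/eqP|p2]; first by rewrite (negPf vN0).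
case: (weight_Hl hq) => [/eqP|q2]; first by rewrite (negPf vN0).
have dE : d = -2 \/ d = 0 \/ d = 2.
  by have := contra_neq (deg_vanish hd) vN0; lia.
have nz u : u = 0 -> v = u -> False by move=> -> e; rewrite e eqxx in vN0.
have dN2 : d <> 2 by move=> e; subst d; exact: nz (vanish_deg2 hq q0 hd) _.
have dNN2 : d <> -2 by move=> e; subst d; exact: nz (vanish_degN2 hp p0 hd) _.
have d0 : d = 0 by lia.
subst d; split.
  suff : p <> 2 by lia.
  move=> e; subst p; apply: (nz v) => //; apply: (sq _ _ _ hp).
  rewrite (weyl_wt2 char0 hbr dimV (triple i)) //.
  rewrite (@deg_vanish (-2 + (-2 + 0)) (br (Y i) _)) ?scaler0 //.
  by do 2 (apply: (wt_br hbr) => //).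
suff : q <> -2 by lia.
move=> e; subst q; apply: (nz v) => //; apply: (sq _ _ _ hq).
rewrite (weyl_wtN2 char0 hbr dimV (triple j)) //.
rewrite (@deg_vanish (2 + (2 + 0)) (br (X j) _)) ?scaler0 //.
by do 2 (apply: (wt_br hbr) => //).
Qed.

(** The joint eigenvalues are integers by the [sl_2] bounds and the grading, so every vector is a
    sum of joint integral weight vectors. *)
Lemma joint_weight_ind i j (P : V -> Prop) : P 0 ->
    (forall u v, P u -> P v -> P (u + v)) ->
    (forall p q d v, wt br (Hl i) p v -> wt br (Hl j) q v -> wt br H0 d v -> P v) ->
  forall v, P v.
Proof.
move=> P0 PD Pw; have H0C l : br H0 (Hl l) = 0.
  by rewrite H0E (br_suml hbr) big1.
apply: (@joint_eigen_ind _ _ [:: ad br (Hl i); ad br (Hl j); ad br H0]) => //.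
- by move=> f; rewrite !inE => /or3P[] /eqP->.
- have comm A B : br A B = 0 -> forall v, br A (br B v) = br B (br A v).
    by move=> AB v; rewrite (brA hbr) AB (br0l hbr) add0r.
  have H0C' l : br (Hl l) H0 = 0 by rewrite (brC hbr) H0C oppr0.
  move=> f g; rewrite !inE => /or3P[] /eqP-> /or3P[] /eqP-> v;
    rewrite !(adE hbr); apply: comm => //; exact: lie_alt hbr _.
move=> v hv.
have [|c hi] := hv (ad br (Hl i)); first by rewrite !inE eqxx.
have [|c' hj] := hv (ad br (Hl j)); first by rewrite !inE eqxx orbT.
have [|d hd] := hv (ad br H0); first by rewrite !inE eqxx !orbT.
rewrite !(adE hbr) in hi hj hd.
have [->|[p _ ep]] := weight_bound char0 hbr (triple i) (@X3 i) (@Y3 i) hi; first exact: P0.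
have [->|[q _ eq]] := weight_bound char0 hbr (triple j) (@X3 j) (@Y3 j) hj; first exact: P0.
have [->|[z _ ez]] := deg_int hd; first exact: P0.
by subst c c' d; apply: Pw hi hj hd.
Qed.
(** For [a != b] this is membership in [Espace br Hl a b 1 (- 1)], expressed with integer
    weights. *)
Definition root_vector (a b : 'I_k.+1) u : Prop :=
  forall l, wt br (Hl l) ((l == a)%:Z - (l == b)%:Z) u.

Lemma deg_of_wts u (z : 'I_k.+1 -> int) : (forall l, wt br (Hl l) (z l) u) ->
  wt br H0 (\sum_l z l) u.
Proof.
move=> hz; rewrite /wt H0E (br_suml hbr) rmorph_sum scaler_suml.
by apply: eq_bigr => l _; rewrite hz.
Qed.

Lemma deg_diff u (a b : 'I_k.+1) :
  root_vector a b u -> wt br H0 0 u.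
Proof.
move/deg_of_wts; rewrite sumrB.
have s1 (c : 'I_k.+1) : \sum_l (l == c)%:Z = 1.
  by rewrite (bigD1 c) //= eqxx big1 // => l /negPf->.
by rewrite !s1 subrr.
Qed.

(** Three brackets with [u] change the weights [(p, q)] into [(p + 3, q - 3)]. The bound 2 forces
    [p < 0 < q] and [q - 3 < 0 < p + 3], so [opposite_weights] requires both [p = -1] and
    [p + 3 = 1]. *)
Lemma root_ad_cube0 (a b : 'I_k.+1) u : a != b ->
  root_vector a b u -> ad_cube0 br u.
Proof.
move=> ab hu; have dx := deg_diff hu.
have hua := hu a; have hub := hu b; rewrite !eqxx (negPf ab) eq_sym (negPf ab) in hua hub.
apply: (@joint_weight_ind a b) => [|v w ev ew|p q d v hp hq hd].
- by rewrite !(br0r hbr).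
- by rewrite !(brDr hbr) ev ew addr0.
have hp3 : wt br (Hl a) (p + 3) (br u (br u (br u v))).
  rewrite (_ : p + 3 = 1 + (1 + (1 + p))); last by ring.
  by do 3 (apply: (wt_br hbr) => //).
have hq3 : wt br (Hl b) (q - 3) (br u (br u (br u v))).
  rewrite (_ : q - 3 = (-1) + ((-1) + ((-1) + q))); last by ring.
  by do 3 (apply: (wt_br hbr) => //).
have hd3 : wt br H0 d (br u (br u (br u v))).
  rewrite (_ : d = 0 + (0 + (0 + d))); last by ring.
  by do 3 (apply: (wt_br hbr) => //).
case: (weight_Hl hp) => [->|p2]; first by rewrite !(br0r hbr).
case: (weight_Hl hq) => [->|q2]; first by rewrite !(br0r hbr).
case: (weight_Hl hp3) => [//|p3]; case: (weight_Hl hq3) => [//|q3].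
have ba : b != a by rewrite eq_sym.
have qpos : 0 < q by lia.
have pneg : p < 0 by lia.
case: (opposite_weights ba hq hp hd qpos pneg) => [->|[? ?]].
  by rewrite !(br0r hbr).
have p3pos : 0 < p + 3 by lia.
have q3neg : q - 3 < 0 by lia.
by case: (opposite_weights ab hp3 hq3 hd3 p3pos q3neg) => // -[]; lia.
Qed.

(** The bracket has degree 2 and weight -1 for [Hl b]. *)
Lemma br_X_root a b u l : a != b -> root_vector a b u -> l != b -> br (X l) u = 0.
Proof.
move=> ab hu lb; apply: (@vanish_deg2 b (0 + -1)) => //.
  apply: (wt_br hbr); first by have := wt_Hl_X b l; rewrite eq_sym (negPf lb).
  by have := hu b; rewrite eqxx eq_sym (negPf ab).
by rewrite -[2]addr0; apply: (wt_br hbr) => //; apply: deg_diff hu.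
Qed.

Lemma br_Y_root a b u l : a != b -> root_vector a b u -> l != a -> br (Y l) u = 0.
Proof.
move=> ab hu la; apply: (@vanish_degN2 a (0 + 1)) => //.
  apply: (wt_br hbr); first by have := wt_Hl_Y a l; rewrite eq_sym (negPf la).
  by have := hu a; rewrite eqxx (negPf ab).
by rewrite -[- 2]addr0; apply: (wt_br hbr) => //; apply: deg_diff hu.
Qed.

(** The bracket has degree 0 and weight -1 for both [Hl b] and [Hl d]. *)
Lemma br_root_root a b c d u v : uniq [:: a; b; c; d] ->
  root_vector a b u -> root_vector c d v -> br u v = 0.
Proof.
rewrite /= !inE !negb_or => /and4P[/and3P[ab ac ad] /andP[bc bd] cd _] hu hv.
apply: (@vanish_deg0 b d (-1 + 0) (0 + -1)) => //.
- apply: (wt_br hbr).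
    by have := hu b; rewrite eqxx eq_sym (negPf ab).
  by have := hv b; rewrite (negPf bc) (negPf bd).
- apply: (wt_br hbr).
    by have := hu d; rewrite eq_sym (negPf ad) eq_sym (negPf bd).
  by have := hv d; rewrite eqxx eq_sym (negPf cd).
by rewrite -[0]addr0; apply: (wt_br hbr); [apply: deg_diff hu | apply: deg_diff hv].
Qed.

(** * The involution exchanging two indices *)

Section Gamma.
Variables (i j : 'I_k.+1) (x y : V).
Hypothesis ij : i != j.
Hypothesis wtx : root_vector i j x.
Hypothesis wty : root_vector j i y.
Hypothesis tr : sl2_triple br y (Hl i - Hl j) x.

Let ji : j != i. Proof. by rewrite eq_sym. Qed.
Let x3 : ad_cube0 br x. Proof. exact: root_ad_cube0 ij wtx. Qed.
Let y3 : ad_cube0 br y. Proof. exact: root_ad_cube0 ji wty. Qed.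

(** The first three letters give [gamma_(i,j)]; the other six give the squared Weyl element of index
    [i], the sign [(-1)^(H_i)], which makes the whole an involution. *)
Definition swap_word := [:: x; y; x; X i; Y i; X i; X i; Y i; X i].
Definition swap := exp_prod br swap_word.

Lemma swap_word_ad_cube0 z : z \in swap_word -> ad_cube0 br z.
Proof. by rewrite !inE; do !case/predU1P => [->//|]; move/eqP->. Qed.

Lemma swapE v : swap v = weyl br y x (weyl br (Y i) (X i) (weyl br (Y i) (X i) v)).
Proof. by rewrite /weyl -!comp_lfunE -!exp_prod_cat. Qed.

Let wi_sq z v : wt br (Hl i) z v ->
  weyl br (Y i) (X i) (weyl br (Y i) (X i) v) = (-1) ^ z *: v.
Proof. exact: weyl_sq. Qed.

Let gamma_sq z v : wt br (Hl i - Hl j) z v ->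
  weyl br y x (weyl br y x v) = (-1) ^ z *: v.
Proof. exact: weyl_sq. Qed.

Let wt_diff p q v : wt br (Hl i) p v -> wt br (Hl j) q v -> wt br (Hl i - Hl j) (p - q) v.
Proof. by rewrite /wt (brBl hbr) => -> ->; rewrite rmorphB /= scalerBl. Qed.

Lemma gamma_aut : lie_automorphism br (weyl br y x).
Proof. by apply: exp_prod_aut => // z; rewrite !inE => /or3P[] /eqP->. Qed.

Lemma gamma_Hi : weyl br y x (Hl i) = Hl j.
Proof.
have n2 := natr_neq0 char0 1; have [_ _ yx] := tr.
have xHi : br x (Hl i) = - x.
  by rewrite (brC hbr) wtx eqxx (negPf ij) scale1r.
have yHi : br y (Hl i) = y.
  by rewrite (brC hbr) wty eqxx (negPf ij) scaleN1r opprK.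
have xHj : br x (Hl j) = x.
  by rewrite (brC hbr) wtx eqxx (negPf ji) scaleN1r opprK.
have xx := lie_alt hbr x; have yy := lie_alt hbr y.
have yHj : br y (Hl j) = - y.
  by rewrite (brC hbr) wty eqxx (negPf ji) scale1r.
rewrite weylE (exp_adE hbr dimV (Hl i) x3) xHi (brNr hbr) xx oppr0 scaler0 addr0.
have -> : exp_ad br y (Hl i - x) = Hl j - x.
  rewrite (exp_adE hbr dimV _ y3) !(brBr hbr) yx !(brBr hbr) yHi yHj.
  rewrite !(brBr hbr, brNr hbr, yHi, yHj, yy).
  by vec; field.
rewrite (exp_adE hbr dimV _ x3) !(brBr hbr) xHj xx (br0r hbr).
by vec; ring.
Qed.

Lemma gamma_Hj : weyl br y x (Hl j) = Hl i.
Proof.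
rewrite -gamma_Hi (gamma_sq (z := 0)) ?expr0z ?scale1r //.
by rewrite /wt (brBl hbr) !HlC subrr scale0r.
Qed.

Lemma swap_Hi : swap (Hl i) = Hl j.
Proof.
by rewrite swapE (wi_sq (z := 0)) ?expr0z ?scale1r ?gamma_Hi // /wt HlC scale0r.
Qed.

Lemma swap_Hj : swap (Hl j) = Hl i.
Proof.
by rewrite swapE (wi_sq (z := 0)) ?expr0z ?scale1r ?gamma_Hj // /wt HlC scale0r.
Qed.

Lemma swap_Hl l : l != i -> l != j -> swap (Hl l) = Hl l.
Proof.
move=> li lj; rewrite swapE (wi_sq (z := 0)) ?expr0z ?scale1r; last first.
  by rewrite /wt HlC scale0r.
apply: exp_prod_fix => // z; rewrite !inE => /or3P[] /eqP->; split=> //;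
  by rewrite (brC hbr) (wtx, wty) (negPf li) (negPf lj) scale0r oppr0.
Qed.

Hypothesis gammaX : weyl br y x (X i) = X j.

Lemma swap_Xi : swap (X i) = X j.
Proof.
rewrite swapE (wi_sq (z := 2)) -?exprnP ?sqrrN ?expr1n ?scale1r //.
by case: (triple i).
Qed.

(** [X i] has the even weight 2 for [Hl i - Hl j], so the square of [gamma] fixes it and [gammaX]
    also determines the image of [X j]. *)
Lemma swap_Xj : swap (X j) = X i.
Proof.
rewrite swapE (wi_sq (z := 0)) ?expr0z ?scale1r; last first.
  by have := wt_Hl_X i j; rewrite (negPf ij).
rewrite -gammaX (gamma_sq (z := 2 - 0)) ?subr0 -?exprnP ?sqrrN ?expr1n ?scale1r //.
rewrite -[X in wt _ _ X _]subr0; apply: wt_diff.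
  by have := wt_Hl_X i i; rewrite eqxx.
by have := wt_Hl_X j i; rewrite (negPf ji).
Qed.

Lemma swap_Xl l : l != i -> l != j -> swap (X l) = X l.
Proof.
move=> li lj; rewrite swapE (wi_sq (z := 0)) ?expr0z ?scale1r; last first.
  by have := wt_Hl_X i l; rewrite eq_sym (negPf li).
apply: exp_prod_fix => // z; rewrite !inE => /or3P[] /eqP->; split=> //;
  rewrite (brC hbr).
- by rewrite (br_X_root ij wtx lj) oppr0.
- by rewrite (br_X_root ji wty li) oppr0.
- by rewrite (br_X_root ij wtx lj) oppr0.
Qed.

(** On weights [(p, q)] the signs are [(-1)^p], then [(-1)^q] because [gamma] exchanges [Hl i] and
    [Hl j], and [(-1)^(p - q)] from the square of [gamma]; the exponents add up to [2 p]. *)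
Lemma swapK v : swap (swap v) = v.
Proof.
apply: (@joint_weight_ind i j (fun v => swap (swap v) = v)) => [|u w eu ew|p q d u hp hq _].
- by rewrite !linear0.
- by rewrite !linearD /= eu ew.
have gu : wt br (Hl i) q (weyl br y x u).
  by rewrite /wt -gamma_Hj -gamma_aut.2 hq linearZ.
rewrite (swapE u) (wi_sq hp) !linearZ /= swapE (wi_sq gu) linearZ /=.
rewrite (gamma_sq (wt_diff hp hq)) !scalerA.
rewrite -!expfzDr ?oppr_eq0 ?oner_eq0 //.
rewrite (_ : p + q + (p - q) = 2 * p); last by ring.
by rewrite -exprz_exp -exprnP sqrrN expr1n exp1rz scale1r.
Qed.

End Gamma.

(** * The product of all swaps, composed with the Weyl element of the total triple *)

Section Involution.
Variables (x y : 'I_k.+1 -> V).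
(** Picks one index from each pair [l], [k - l]; a middle index, fixed by [rev_ord], is left out. *)
Let half (l : 'I_k.+1) := (l < rev_ord l)%N.
Hypothesis wtx : forall l, half l -> root_vector l (rev_ord l) (x l).
Hypothesis wty : forall l, half l -> root_vector (rev_ord l) l (y l).
Hypothesis trxy : forall l, half l -> sl2_triple br (y l) (Hl l - Hl (rev_ord l)) (x l).
Hypothesis gammaX : forall l, half l -> weyl br (y l) (x l) (X l) = X (rev_ord l).

Let half_neq l : half l -> l != rev_ord l.
Proof. by rewrite -val_eqE /half neq_ltn => ->. Qed.

Definition flip_word (l : 'I_k.+1) := swap_word l (x l) (y l).
Definition flip l := exp_prod br (flip_word l).
Definition flips_word (L : seq 'I_k.+1) := flatten (map flip_word L).
Definition flips L := exp_prod br (flips_word L).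

Let flips_cons l L v : flips (l :: L) v = flip l (flips L v).
Proof.
rewrite /flips -[flips_word (l :: L)]/(flip_word l ++ flips_word L).
by rewrite exp_prod_cat lfunE.
Qed.

Lemma flip_word_ad_cube0 l : half l -> forall z, z \in flip_word l -> ad_cube0 br z.
Proof. by move=> hl; apply: swap_word_ad_cube0 (half_neq hl) (wtx hl) (wty hl). Qed.

Lemma flips_word_ad_cube0 L : all half L -> forall z, z \in flips_word L -> ad_cube0 br z.
Proof.
by move=> /allP hL z /flattenP[_ /mapP[l /hL hl ->]]; apply: flip_word_ad_cube0.
Qed.

Lemma flips_aut L : all half L -> lie_automorphism br (flips L).
Proof. by move=> hL; apply: exp_prod_aut (flips_word_ad_cube0 hL). Qed.

Lemma flip_aut l : half l -> lie_automorphism br (flip l).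
Proof. by move=> hl; apply: exp_prod_aut (flip_word_ad_cube0 hl). Qed.

Lemma flip_X l m : half l ->
  flip l (X m) = X (if (m == l) || (m == rev_ord l) then rev_ord m else m).
Proof.
move=> hl; have ne := half_neq hl.
have [->|ml] := eqVneq m l; first exact: swap_Xi (gammaX hl).
have [->|mr] := eqVneq m (rev_ord l); last first.
  refine (swap_Xl ne (wtx hl) (wty hl) ml mr).
by rewrite rev_ordK; apply: swap_Xj ne (wtx hl) (wty hl) (trxy hl) (gammaX hl).
Qed.

Lemma flip_H l m : half l ->
  flip l (Hl m) = Hl (if (m == l) || (m == rev_ord l) then rev_ord m else m).
Proof.
move=> hl; have ne := half_neq hl.
have [->|ml] := eqVneq m l; first by apply: swap_Hi ne (wtx hl) (wty hl) (trxy hl).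
have [->|mr] := eqVneq m (rev_ord l); last first.
  refine (swap_Hl ne (wtx hl) (wty hl) ml mr).
by rewrite rev_ordK; apply: swap_Hj ne (wtx hl) (wty hl) (trxy hl).
Qed.

Lemma flipK l v : half l -> flip l (flip l v) = v.
Proof.
by move=> hl; apply: swapK (half_neq hl) (wtx hl) (wty hl) (trxy hl) _.
Qed.

(** The indices [l], [k - l], [m], [k - m] are distinct, as [l] and [m] both lie in the lower half.
    All letters then commute, by weight, by degree or by [XY0]. *)
Lemma flip_word_comm l m z u : half l -> half m -> l != m ->
  z \in flip_word l -> u \in flip_word m -> br z u = 0.
Proof.
move=> hl hm lm.
have [nl nm] := (half_neq hl, half_neq hm).
have rlm : rev_ord l != rev_ord m by rewrite (inj_eq rev_ord_inj).
have [lrm rlm'] : l != rev_ord m /\ rev_ord l != m.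
  by move: hl hm; rewrite /half -!val_eqE /=; lia.
have un : uniq [:: l; rev_ord l; m; rev_ord m].
  by rewrite /= !inE !negb_or nl lm lrm rlm' rlm nm.
have un2 : uniq [:: rev_ord l; l; m; rev_ord m].
  by rewrite /= !inE !negb_or eq_sym nl lm lrm rlm' rlm nm.
have un3 : uniq [:: l; rev_ord l; rev_ord m; m].
  by rewrite /= !inE !negb_or nl lm lrm rlm' rlm eq_sym nm.
have un4 : uniq [:: rev_ord l; l; rev_ord m; m].
  by rewrite /= !inE !negb_or eq_sym nl lm lrm rlm' rlm [rev_ord m == m]eq_sym nm.
have [nl' nm'] : rev_ord l != l /\ rev_ord m != m by rewrite !(eq_sym (rev_ord _)).
have ml : m != l by rewrite eq_sym.
have mrl : m != rev_ord l by rewrite eq_sym.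
have brx : br (x l) (x m) = 0 := br_root_root un (wtx hl) (wtx hm).
have zs a : a \in flip_word l -> a \in [:: x l; y l; X l; Y l].
  by rewrite !inE; do !case/orP => [->|]; rewrite ?orbT // => ->; rewrite ?orbT.
have us a : a \in flip_word m -> a \in [:: x m; y m; X m; Y m].
  by rewrite !inE; do !case/orP => [->|]; rewrite ?orbT // => ->; rewrite ?orbT.
move=> /zs zA /us; move: zA; rewrite !inE => /or4P[] /eqP-> /or4P[] /eqP->.
- exact: brx.
- by apply: (br_root_root un3 (wtx hl) (wty hm)).
- by rewrite (brC hbr) (br_X_root nl (wtx hl)) ?oppr0.
- by rewrite (brC hbr) (br_Y_root nl (wtx hl)) ?oppr0.
- by apply: (br_root_root un2 (wty hl) (wtx hm)).
- by apply: (br_root_root un4 (wty hl) (wty hm)).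
- by rewrite (brC hbr) (br_X_root nl' (wty hl)) ?oppr0.
- by rewrite (brC hbr) (br_Y_root nl' (wty hl)) ?oppr0.
- by rewrite (br_X_root nm (wtx hm)).
- by rewrite (br_X_root nm' (wty hm)).
- by apply: (@deg_vanish (2 + 2)) => //; apply: (wt_br hbr).
- exact: XY0.
- by rewrite (br_Y_root nm (wtx hm)).
- by rewrite (br_Y_root nm' (wty hm)).
- by rewrite (brC hbr) XY0 ?oppr0.
- by apply: (@deg_vanish (-2 + -2)) => //; apply: (wt_br hbr).
Qed.

Lemma flip_flips l L v : half l -> all half L -> l \notin L ->
  flip l (flips L v) = flips L (flip l v).
Proof.
move=> hl /allP hL lL; have [_ fM] := flip_aut hl.
have /lfunP/(_ v) : (flip l \o flips L = flips L \o flip l)%VF.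
  apply: (exp_prod_comm hbr fM) => u /flattenP[_ /mapP[m mL ->] um].
  apply: exp_prod_fix => // z zl; split; first exact: flip_word_ad_cube0 zl.
  by apply: flip_word_comm (hL m mL) _ zl um => //; apply: contraNneq lL => ->.
by rewrite !comp_lfunE.
Qed.

Lemma flipsK L v : uniq L -> all half L -> flips L (flips L v) = v.
Proof.
elim: L v => [|l L IH] v; first by rewrite /flips /= !lfunE.
move=> /andP[lL uL] /andP[hl hL].
rewrite (flips_cons l L v) (flips_cons l L) -(flip_flips (flips L v) hl hL lL).
by rewrite (flipK _ hl) (IH v uL hL).
Qed.

(** Used for [Z] equal to [X] and to [Hl]. Each index is moved by at most one flip of the list. *)
Lemma flips_perm (Z : 'I_k.+1 -> V) L m : (forall l m, half l ->
    flip l (Z m) = Z (if (m == l) || (m == rev_ord l) then rev_ord m else m)) ->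
  uniq L -> all half L ->
  flips L (Z m) = Z (if (m \in L) || (rev_ord m \in L) then rev_ord m else m).
Proof.
move=> hZ; elim: L m => [|l L IH] m; first by rewrite /flips /= lfunE.
move=> /andP[lL uL] /andP[hl hL]; rewrite flips_cons IH // hZ // !inE.
have lrL : rev_ord l \notin L.
  by apply/negP => /(allP hL); move: hl; rewrite /half rev_ordK; lia.
have rE a : (rev_ord a == l) = (a == rev_ord l) by rewrite -(inj_eq rev_ord_inj) rev_ordK.
have [->|ml] := eqVneq m l.
  by rewrite (negPf lL) (negPf lrL) /= eqxx.
have [->|mr] := eqVneq m (rev_ord l).
  by rewrite rev_ordK (negPf lL) (negPf lrL) /= !eqxx !orbT /= rev_ordK.
rewrite rE (negPf mr) /=; case: ((m \in L) || _); last by rewrite (negPf ml) (negPf mr).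
by rewrite rE (negPf mr) (inj_eq rev_ord_inj) (negPf ml).
Qed.

Let L := [seq l <- enum 'I_k.+1 | half l].
Let halfL : all half L. Proof. exact: filter_all. Qed.
Let uniqL : uniq L. Proof. by rewrite filter_uniq ?enum_uniq. Qed.

Lemma flips_rev (Z : 'I_k.+1 -> V) m : (forall l m, half l ->
    flip l (Z m) = Z (if (m == l) || (m == rev_ord l) then rev_ord m else m)) ->
  flips L (Z m) = Z (rev_ord m).
Proof.
have memL a : (a \in L) = half a by rewrite mem_filter mem_enum andbT.
move=> hZ; rewrite (flips_perm _ hZ) // !memL /half rev_ordK.
by case: ltngtP => [||/val_inj <-].
Qed.

Let Ip := \sum_j X j.
Let Im := \sum_j Y j.

Lemma total_triple : sl2_triple br Im H0 Ip.
Proof.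
split.
- by rewrite (br_sumr hbr) scaler_sumr; apply: eq_bigr => j _; apply: degX.
- rewrite (br_sumr hbr) scaler_sumr -sumrN; apply: eq_bigr => j _.
  by rewrite degY rmorphN scaleNr.
rewrite (br_suml hbr) H0E; apply: eq_bigr => j _.
rewrite (br_sumr hbr) (bigD1 j) //= big1 ?addr0; first by case: (triple j).
by move=> l lj; rewrite (brC hbr) XY0 ?oppr0.
Qed.

Let Ip3 : ad_cube0 br Ip. Proof. by apply: deg2_ad_cube0; case: total_triple. Qed.
Let Im3 : ad_cube0 br Im.
Proof. by apply: degN2_ad_cube0; case: total_triple => _ h _; rewrite /wt h rmorphN scaleNr. Qed.

(** The difference has weight -2 and is killed by [Z], which is injective on negative weights. *)
Lemma sl2_uniqueY Yo Yn H Z : ad_cube0 br Yo -> sl2_triple br Yo H Z ->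
  sl2_triple br Yn H Z -> Yn = Yo.
Proof.
move=> Yo3 to [_ hYn hn]; have [_ hYo ho] := to; apply/eqP; rewrite -subr_eq0; apply/eqP.
apply: (lowering_inj char0 hbr to Yo3 (z := -2)) => //.
  by rewrite /wt (brBr hbr) hYn hYo; vec; ring.
by rewrite (brC hbr) (brBl hbr) hn ho subrr oppr0.
Qed.

Let w := weyl br Im Ip.
Let t := flips L.

Lemma total_weyl_X j : w (X j) = Y j.
Proof.
have IpH : br Ip (Hl j) = - (2%:R *: X j).
  rewrite (br_suml hbr) (bigD1 j) //= big1 ?addr0 => [|l lj].
    by rewrite (brC hbr) (wt_Hl_X j j) eqxx.
  by rewrite (brC hbr) (wt_Hl_X j l) eq_sym (negPf lj) scale0r oppr0.
have ImH : br Im (Hl j) = 2%:R *: Y j.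
  rewrite (br_suml hbr) (bigD1 j) //= big1 ?addr0 => [|l lj].
    by rewrite (brC hbr) (wt_Hl_Y j j) eqxx rmorphN scaleNr opprK.
  by rewrite (brC hbr) (wt_Hl_Y j l) eq_sym (negPf lj) scale0r oppr0.
apply: (weyl_X char0 hbr dimV Ip3 Im3 (H' := Hl j)) => //.
- by apply: (@deg_vanish (2 + 2)) => //; apply: (wt_br hbr) => //; case: total_triple.
- rewrite (br_suml hbr) (bigD1 j) //= big1 ?addr0; first by case: (triple j).
  by move=> l lj; rewrite (brC hbr) XY0 ?oppr0 // eq_sym.
rewrite (br_suml hbr) (bigD1 j) //= big1 ?addr0; last by move=> l lj; rewrite XY0.
by rewrite (brC hbr); case: (triple j) => _ _ ->.
Qed.

Lemma total_weylK v : w (w v) = v.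
Proof.
have [vm [v0 [vp [-> hm h0 hp]]]] := grading v.
have sq := weyl_sq char0 hbr dimV total_triple Ip3 Im3.
rewrite !linearD /= /w !(sq _ _ hm, sq _ _ h0, sq _ _ hp).
have -> : (-1 : F) ^ (- 2 : int) = 1 by rewrite -[LHS]/(((-1) ^+ 2)^-1) sqrrN expr1n invr1.
by rewrite expr0z -exprnP sqrrN expr1n !scale1r.
Qed.

Lemma total_weyl_aut : lie_automorphism br w.
Proof. by apply: exp_prod_aut => // z; rewrite !inE => /or3P[] /eqP->. Qed.

(** Being an involution, [w] exchanges [X j] and [Y j], hence reverses [Hl j = [Y j, X j]]. *)
Lemma total_weyl_H j : w (Hl j) = - Hl j.
Proof.
have [_ _ <-] := triple j.
by rewrite total_weyl_aut.2 total_weyl_X -{1}total_weyl_X total_weylK (brC hbr).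
Qed.

Lemma flips_total_weyl v : t (w v) = w (t v).
Proof.
have [_ tM] := flips_aut halfL.
have tp : t Ip = Ip.
  rewrite [LHS]linear_sum [RHS](reindex_inj rev_ord_inj); apply: eq_bigr => j _.
  exact: flips_rev flip_X.
have th : t H0 = H0.
  rewrite H0E [LHS]linear_sum [RHS](reindex_inj rev_ord_inj); apply: eq_bigr => j _.
  exact: flips_rev flip_H.
have tm : t Im = Im.
  apply: (sl2_uniqueY Im3 total_triple).
  have [e1 e2 e3] := total_triple.
  split; first exact: e1; last by rewrite -{1}tp -tM e3.
  by rewrite -{1}th -tM e2 linearN linearZ.
have /lfunP/(_ v) : (t \o w = w \o t)%VF.
  by apply: (exp_prod_comm hbr tM) => z; rewrite !inE => /or3P[] /eqP->.
by rewrite !comp_lfunE.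
Qed.

(** The involution is delivered as a word in ad-nilpotent elements, so that it remains visibly
    elementary after extension of scalars. *)
Lemma diagonal_involution : exists2 s : seq V, (forall z, z \in s -> ad_cube0 br z) &
  [/\ forall j, exp_prod br s (Hl j) = - Hl (rev_ord j),
      forall j, exp_prod br s (X j) = Y (rev_ord j)
    & (exp_prod br s \o exp_prod br s = \1)%VF].
Proof.
have E v : exp_prod br ([:: Ip; Im; Ip] ++ flips_word L) v = w (t v).
  by rewrite exp_prod_cat lfunE.
exists ([:: Ip; Im; Ip] ++ flips_word L).
  move=> z; rewrite mem_cat => /orP[|/(flips_word_ad_cube0 halfL)//].
  by rewrite !inE => /or3P[] /eqP->.
split=> [j|j|]; rewrite ?E.
- by rewrite /t flips_rev ?total_weyl_H //; apply: flip_H.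
- by rewrite /t flips_rev ?total_weyl_X //; apply: flip_X.
by apply/lfunP => v; rewrite !lfunE /= !E flips_total_weyl total_weylK /t flipsK.
Qed.

End Involution.
End Diagonal.

(** * Extension of scalars *)

Section BaseChange.
Variables (F Fbar : fieldType) (iota : {rmorphism F -> Fbar}).
Variables (V : vectType F) (br : V -> V -> V) (hbr : lie_bracket br).

Local Notation n := (\dim {:V}).
Local Notation b := (vbasis {:V}).
Local Notation W := (bar_space Fbar V).
Local Notation bvec := (@bar_vec _ _ iota V).
Local Notation bend := (@bar_end _ _ iota V).
Local Notation bbr := (bar_br iota br).

Lemma bar_vecE v i : (bvec v : 'rV_n) 0 i = iota (coord b i v).
Proof. by rewrite mxE. Qed.

Lemma bar_ext (u v : W) : (forall i, (u : 'rV_n) 0 i = (v : 'rV_n) 0 i) -> u = v.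
Proof. by move=> e; apply/rowP. Qed.

Lemma bar_vecD u v : bvec (u + v) = bvec u + bvec v.
Proof. by apply: bar_ext => i; rewrite !mxE linearD rmorphD. Qed.

Lemma bar_vecZ c v : bvec (c *: v) = iota c *: bvec v.
Proof. by apply: bar_ext => i; rewrite !mxE linearZ rmorphM. Qed.

Lemma bar_vec0 : bvec 0 = 0.
Proof. by apply: bar_ext => i; rewrite !mxE linear0 rmorph0. Qed.

Lemma bar_vec_sum I (r : seq I) (P : pred I) (E : I -> V) :
  bvec (\sum_(i <- r | P i) E i) = \sum_(i <- r | P i) bvec (E i).
Proof. by apply: (big_morph bvec bar_vecD bar_vec0). Qed.

Lemma bar_endE f (u : W) : bend f u = \sum_(i < n) (u : 'rV_n) 0 i *: bvec (f b`_i).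
Proof.
pose h (u : W) : W := \sum_(i < n) (u : 'rV_n) 0 i *: bvec (f b`_i).
have hl : linear h.
  move=> c v w; rewrite /h scaler_sumr -big_split; apply: eq_bigr => i _ /=.
  by rewrite !mxE scalerDl scalerA.
pose m := GRing.isLinear.Build Fbar W W *:%R h hl.
pose g : {linear W -> W} := HB.pack h m.
by rewrite /bar_end -[LHS]/(linfun g u) lfunE.
Qed.

Lemma bar_end_vec f v : bend f (bvec v) = bvec (f v).
Proof.
rewrite bar_endE {2}(coord_vbasis (memvf v)) linear_sum bar_vec_sum.
by apply: eq_bigr => i _; rewrite bar_vecE linearZ bar_vecZ.
Qed.

Lemma bar_expand (u : W) : u = \sum_(i < n) (u : 'rV_n) 0 i *: bvec b`_i.
Proof.
apply: bar_ext => i; rewrite summxE (bigD1 i) //= big1 => [|j ji]; rewrite !mxE.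
  by rewrite coord_free ?(basis_free (vbasisP _)) // eqxx rmorph1 mulr1 addr0.
by rewrite coord_free ?(basis_free (vbasisP _)) // (negPf ji) rmorph0 mulr0.
Qed.

(** The image of [V] spans the extended space. *)
Lemma bar_end_ext (f g : 'End(W)) : (forall v, f (bvec v) = g (bvec v)) -> f = g.
Proof.
move=> e; apply/lfunP => u; rewrite (bar_expand u) !linear_sum.
by apply: eq_bigr => i _; rewrite !linearZ /= e.
Qed.

Lemma bar_end_comp f g : bend (f \o g)%VF = (bend f \o bend g)%VF.
Proof. by apply: bar_end_ext => v; rewrite comp_lfunE !bar_end_vec comp_lfunE. Qed.

Lemma bar_end1 : bend \1%VF = \1%VF.
Proof. by apply: bar_end_ext => v; rewrite bar_end_vec !id_lfunE. Qed.

Lemma bar_end0 : bend 0 = 0.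
Proof. by apply: bar_end_ext => v; rewrite bar_end_vec !zero_lfunE bar_vec0. Qed.

Lemma bar_endD f g : bend (f + g) = bend f + bend g.
Proof. by apply: bar_end_ext => v; rewrite add_lfunE !bar_end_vec add_lfunE bar_vecD. Qed.

Lemma bar_endZ c f : bend (c *: f) = iota c *: bend f.
Proof. by apply: bar_end_ext => v; rewrite scale_lfunE !bar_end_vec scale_lfunE bar_vecZ. Qed.

Lemma bar_end_iter m f : bend (iter_lfun m f) = iter_lfun m (bend f).
Proof.
elim: m => [|m IH]; first exact: bar_end1.
by rewrite -[iter_lfun m.+1 f]/(f \o iter_lfun m f)%VF bar_end_comp IH.
Qed.

Lemma bar_end_ad v : bend (ad br v) = ad bbr (bvec v).
Proof.
have hl : linear (bbr (bvec v)).
  move=> c u w; rewrite /bar_br scaler_sumr -big_split; apply: eq_bigr => i _ /=.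
  rewrite scaler_sumr -big_split; apply: eq_bigr => j _ /=.
  by rewrite !mxE scalerA -scalerDl mulrDr mulrCA.
pose m := GRing.isLinear.Build Fbar W W *:%R (bbr (bvec v)) hl.
pose g : {linear W -> W} := HB.pack (bbr (bvec v)) m.
apply/lfunP => u; rewrite bar_endE /ad -[RHS]/(linfun g u) lfunE /= /bar_br.
rewrite exchange_big; apply: eq_bigr => j _ /=.
rewrite -/(ad br v) adE // {1}(coord_vbasis (memvf v)) br_suml // bar_vec_sum scaler_sumr.
by apply: eq_bigr => i _; rewrite brZl // bar_vecZ scalerA bar_vecE mulrC.
Qed.

Lemma dim_bar : \dim {:W} = n.
Proof. by rewrite dimvf dim_matrix; exact: mul1r. Qed.

(** By [dim_bar] the two truncated series have the same length and can be compared term by term. *)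
Lemma bar_end_exp_ad v : bend (exp_ad br v) = exp_ad bbr (bvec v).
Proof.
rewrite /exp_ad /exp_nilp dim_bar (big_morph bend bar_endD bar_end0).
by apply: eq_bigr => m _; rewrite bar_endZ bar_end_iter bar_end_ad fmorphV rmorph_nat.
Qed.

Lemma bar_exp_prod s : bend (exp_prod br s) = exp_prod bbr (map bvec s).
Proof. by elim: s => [|v s IH] /=; rewrite ?bar_end1 // bar_end_comp bar_end_exp_ad IH. Qed.

Lemma ad_cube0_nilpotent v : ad_cube0 br v -> nilpotent_end (ad bbr (bvec v)).
Proof.
move=> hv; exists 3; rewrite -bar_end_ad -bar_end_iter -[RHS]bar_end0; congr (bend _).
by apply/lfunP => u; rewrite /iter_lfun /= !comp_lfunE id_lfunE zero_lfunE !(adE hbr).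
Qed.

Lemma exp_prod_elementary s : (forall v, v \in s -> ad_cube0 br v) ->
  elementary bbr (bend (exp_prod br s)).
Proof.
move=> hs; exists (map bvec s); split; last exact: bar_exp_prod.
by move=> _ /mapP[v /hs hv ->]; apply: ad_cube0_nilpotent.
Qed.

Lemma Aut0_comp f g : Aut0 iota br f -> Aut0 iota br g -> Aut0 iota br (f \o g)%VF.
Proof.
move=> [fa [s [hs fs]]] [ga [t [ht gs]]]; split; first exact: lie_aut_comp.
exists (s ++ t); split.
  by move=> v; rewrite mem_cat => /orP[/hs|/ht].
by rewrite bar_end_comp fs gs -!/(exp_prod _ _) exp_prod_cat.
Qed.

End BaseChange.

(** * Split tori *)

Section SplitTorus.
Variables (F : fieldType) (char0 : [pchar F] =i pred0) (V : vectType F).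
Local Notation n := (\dim {:V}).

Lemma diag_end (b : n.-tuple V) (d : 'I_n -> F) : basis_of fullv b ->
  exists f : 'End(V), forall i, f (tnth b i) = d i *: tnth b i.
Proof.
move=> bV; pose h v := \sum_i (coord b i v * d i) *: tnth b i.
have hl : linear h.
  move=> c v w; rewrite /h scaler_sumr -big_split; apply: eq_bigr => i _ /=.
  by rewrite linearP mulrDl scalerDl scalerA -mulrA.
pose m := GRing.isLinear.Build F V V *:%R h hl.
pose g : {linear V -> V} := HB.pack h m.
exists (linfun g) => i; rewrite lfunE /= /h (bigD1 i) //= big1 => [|j ji].
  by rewrite (tnth_nth 0) coord_free ?(basis_free bV) // eqxx mul1r addr0.
by rewrite [tnth b i](tnth_nth 0) coord_free ?(basis_free bV) // eq_sym (negPf ji) mul0r scale0r.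
Qed.

Lemma expfz_prod I (s : seq I) (E : I -> F) (z : int) :
  (\prod_(i <- s) E i) ^ z = \prod_(i <- s) E i ^ z.
Proof. by apply: (big_morph (fun x : F => x ^ z)) => [u v|]; rewrite ?expfzMl ?exp1rz. Qed.

Lemma expfz_sum I (s : seq I) (E : I -> int) (x : F) : x != 0 ->
  x ^ (\sum_(i <- s) E i) = \prod_(i <- s) x ^ E i.
Proof.
by move=> x0; apply: (big_morph (fun z : int => x ^ z)) => [u v|]; rewrite ?expfzDr ?expr0z.
Qed.

Lemma basis_coord (b : n.-tuple V) v : basis_of fullv b ->
  v = \sum_i coord b i v *: tnth b i.
Proof.
move=> bV; have vb : v \in <<b>>%VS by rewrite (span_basis bV) memvf.
by rewrite {1}(coord_span vb); apply: eq_bigr => i _; rewrite (tnth_nth 0).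
Qed.

Lemma eigen_coord (b : n.-tuple V) (f : 'End(V)) (d : 'I_n -> F) c v i :
  basis_of fullv b -> (forall i, f (tnth b i) = d i *: tnth b i) ->
  f v = c *: v -> coord b i v != 0 -> d i = c.
Proof.
move=> bV fb fv vi; apply: (mulIf vi).
have := congr1 (coord b i) fv; rewrite linearZ /= => <-.
rewrite {2}(basis_coord v bV) !linear_sum /= (bigD1 i) //= big1 => [|j ji].
  rewrite !linearZ /= fb linearZ /= (tnth_nth 0) coord_free ?(basis_free bV) //.
  by rewrite eqxx mulr1 addr0 mulrC.
rewrite !linearZ /= fb linearZ /= (tnth_nth 0) coord_free ?(basis_free bV) //.
by rewrite (negPf ji) !mulr0.
Qed.

(* The weights of T on a basis adapted to T' are the same linear forms on h as
   the weights of T', and satisfy the same integral relations. *)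
Lemma split_torus_sub (T T' h : 'End(V) -> Prop) :
  split_torus_with_Lie T h -> split_torus_with_Lie T' h -> forall f, T f -> T' f.
Proof.
move=> [b [r [m [bV _ TE hE]]]] [b' [r' [m' [bV' gen' TE' hE']]]] f /TE[t [t0 ft]].
(* [s l] indexes a vector of [b] that occurs in the [l]-th vector of [b']. *)
have [s hs] : exists s : 'I_n -> 'I_n, forall l, coord b (s l) (tnth b' l) != 0.
  apply: (fin_all_exists (P := fun l i => coord b i (tnth b' l) != 0)) => l.
  have [/existsP[i ?]|/existsPn h0] := boolP [exists i, coord b i (tnth b' l) != 0].
    by exists i.
  have : tnth b' l = 0.
    rewrite (basis_coord (tnth b' l) bV) big1 // => i _.
    by have := h0 i; rewrite negbK => /eqP ->; rewrite scale0r.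
  by move=> e; have := free_not0 (basis_free bV') (mem_tnth l b'); rewrite e eqxx.
pose mF := map_mx (intr : int -> F) m; pose mF' := map_mx (intr : int -> F) m'.
have linE q (a : 'M[int]_(n, q)) (x : 'cV[F]_q) i :
    (map_mx intr a *m x) i 0 = \sum_(j < q) x j 0 *~ a i j.
  by rewrite mxE; apply: eq_bigr => j _; rewrite mxE mulrC mulrzr.
(* An element of [h] is diagonal in both bases, with equal eigenvalues on vectors of [b] and [b']
   that meet. *)
have same_form (x : 'cV[F]_r) : exists x' : 'cV[F]_r', forall l i,
    coord b i (tnth b' l) != 0 -> (mF *m x) i 0 = (mF' *m x') l 0.
  have [g gb] := diag_end (fun i => \sum_(j < r) x j 0 *~ m i j) bV.
  have /hE'[x' gb'] : h g by apply/hE; exists (fun j => x j 0).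
  exists (\col_j x' j) => l i li; rewrite !linE.
  rewrite (eigen_coord bV gb (gb' l) li).
  by apply: eq_bigr => j _; rewrite mxE.
have same_row l i : coord b i (tnth b' l) != 0 -> row i m = row (s l) m.
  move=> li; apply/rowP => j; rewrite !mxE; apply: (intr_inj0 char0).
  have [x' e] := same_form (delta_mx j 0).
  have colE a : (mF *m delta_mx j (0 : 'I_1)) a 0 = (m a j)%:~R.
    by rewrite -colE !mxE.
  by rewrite -!colE (e _ _ li) (e _ _ (hs l)).
(* Since the weights of [T'] generate the lattice, [m'] has an integral left inverse [Dm]. *)
have [D DE] : exists D : 'I_r' -> 'rV[int]_n, forall j, delta_mx 0 j = D j *m m'.
  by apply: (fin_all_exists (P := fun j d => delta_mx 0 j = d *m m')) => j; apply: gen'.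
pose Dm := \matrix_j D j; have Dm1 : Dm *m m' = 1%:M.
  by apply/row_matrixP => j; rewrite row_mul rowK -DE rowE mulmx1.
pose M := \matrix_l row (s l) m.
(* Over [F] the column space of [M] lies in that of [m'], on which [m' Dm] is the identity; the
   equality descends to integers in characteristic 0. *)
have ME : m' *m Dm *m M = M.
  pose mapF p q (a : 'M[int]_(p, q)) := map_mx (intr : int -> F) a.
  suff e : mapF _ _ (m' *m Dm *m M) = mapF _ _ M.
    by apply/matrixP => i j; have /matrixP/(_ i j) := e; rewrite !mxE => /(intr_inj0 char0).
  have MF (x : 'cV[F]_r) : exists x', mapF _ _ M *m x = mF' *m x'.
    have [x' e] := same_form x; exists x'; apply/colP => l.
    rewrite -(e _ _ (hs l)) !mxE; apply: eq_bigr => j _.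
    by rewrite !mxE.
  apply/matrixP => i j.
  have colj (B : 'M[F]_(n, r)) : B i j = (B *m delta_mx j (0 : 'I_1)) i 0.
    by rewrite -colE mxE.
  rewrite !colj; have [x' e] := MF (delta_mx j 0).
  rewrite /mapF !map_mxM /= -/(mapF _ _ M) -!mulmxA e.
  by rewrite [map_mx _ Dm *m _]mulmxA -map_mxM Dm1 map_mx1 mul1mx.
(* The scalar by which [f] acts on the [l]-th vector of [b']. *)
pose chi l := \prod_(j < r) t j ^ m (s l) j.
have chi0 l : chi l != 0 by apply/prodf_neq0 => j _; rewrite expfz_neq0.
(* With the parameters [chi^Dm], the weights of [T'] give
   [chi^(m' Dm) = t^(m' Dm M) = t^M = chi]. *)
apply/TE'; exists (fun j => \prod_(q < n) chi q ^ Dm j q); split=> [j|l].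
  by apply/prodf_neq0 => q _; rewrite expfz_neq0.
have -> : \prod_(j < r') (\prod_(q < n) chi q ^ Dm j q) ^ m' l j = chi l.
  under eq_bigr => j _ do rewrite expfz_prod.
  rewrite exchange_big /=.
  transitivity (\prod_(q < n) chi q ^ (m' *m Dm) l q).
    apply: eq_bigr => q _; rewrite mxE expfz_sum //.
    by apply: eq_bigr => j _; rewrite exprz_exp mulrC.
  under eq_bigr => q _ do rewrite expfz_prod.
  rewrite exchange_big /=; apply: eq_bigr => j _.
  have -> : m (s l) j = (m' *m Dm *m M) l j by rewrite ME !mxE.
  rewrite mxE expfz_sum //; apply: eq_bigr => q _.
  by rewrite exprz_exp !mxE mulrC.
rewrite {1}(basis_coord (tnth b' l) bV) linear_sum [in RHS](basis_coord (tnth b' l) bV).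
rewrite scaler_sumr; apply: eq_bigr => i _; rewrite linearZ /= ft !scalerA.
have [->|li] := eqVneq (coord b i (tnth b' l)) 0; first by rewrite mul0r mulr0.
rewrite mulrC; congr (_ * _ *: _); apply: eq_bigr => j _.
by have /rowP/(_ j) := same_row _ _ li; rewrite !mxE => ->.
Qed.

Lemma split_torus_conj (T h : 'End(V) -> Prop) (c : 'End(V)) : (c \o c)%VF = \1%VF ->
  split_torus_with_Lie T h ->
  split_torus_with_Lie (fun f => T (c \o f \o c)%VF) (fun f => h (c \o f \o c)%VF).
Proof.
move=> cc [b [r [m [bV gen TE hE]]]].
have ccE v : c (c v) = v by rewrite -comp_lfunE cc id_lfunE.
exists [tuple of map c b], r, m; split=> //.
- have c0 : lker c = 0%VS.
    apply/eqP; rewrite -subv0; apply/subvP => v.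
    by rewrite memv_ker memv0 -{2}(ccE v) => /eqP->; rewrite linear0.
  have e : (c @: fullv)%VS = fullv.
    apply/eqP; rewrite eqEsubv subvf; apply/subvP => v _.
    by rewrite -(ccE v) memv_img ?memvf.
  by have := @limg_basis_of _ _ _ c _ _ _ bV; rewrite e; apply; rewrite c0 capv0.
- move=> f; rewrite TE; split=> -[t [t0 ft]]; exists t; split=> // i.
    by rewrite tnth_map -linearZ /= -ft !comp_lfunE ccE.
  by have := ft i; rewrite tnth_map !comp_lfunE => ->; rewrite linearZ /= ccE.
- move=> f; rewrite hE; split=> -[x fx]; exists x => i.
    by rewrite tnth_map -linearZ /= -fx !comp_lfunE ccE.
  by have := fx i; rewrite tnth_map !comp_lfunE => ->; rewrite linearZ /= ccE.
Qed.

End SplitTorus.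

(** * Action of the involution on the groups *)

(** If a prime [q] vanished in [K], then [nu] of it would be 0, whereas the p-adic absolute value of
    the rational number [q] is a power of [p]. *)
Lemma pchar_Qp p (K : fieldType) (nu : K -> rat) : is_Qp p nu -> [pchar K] =i pred0.
Proof.
move=> hK q; apply/negP => /andP[/= q_prime /eqP q0].
have p0 : p%:R != 0 :> rat by rewrite pnatr_eq0 -lt0n prime_gt0 // (Qp_prime hK).
have nuq : nu (ratr q%:R) = 0.
  apply: (Qp_abs0 hK _).2; rewrite /ratr -[q%:R]/((q%:Z)%:~R : rat).
  by rewrite numq_int -pmulrn q0 mul0r.
move: (Qp_rat hK q%:R); rewrite nuq /padic_abs pnatr_eq0.
case: q q_prime {q0 nuq} => // q _ /= /esym/eqP.
by rewrite expfz_eq0 (negPf p0) andbF.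
Qed.

Section Espace.
Variables (F : fieldType) (V : vectType F) (br : V -> V -> V) (hbr : lie_bracket br).
Variables (k : nat) (Hl : 'I_k.+1 -> V).

Lemma mem_eigenspace_ad H c v : (v \in eigenspace_ad br H c) = (br H v == c *: v).
Proof. by rewrite mem_eigen adE. Qed.

Lemma mem_Espace i j p q v : reflect
  [/\ br (Hl i) v = p *: v, br (Hl j) v = q *: v
    & forall s, s != i -> s != j -> br (Hl s) v = 0]
  (v \in Espace br Hl i j p q).
Proof.
rewrite !memv_cap !mem_eigenspace_ad -andbA.
apply: (iffP and3P) => -[].
  move=> /eqP hi /eqP hj; rewrite memvE => /subv_bigcapP hs; split=> // s si sj.
  by have := hs s; rewrite si sj -memvE mem_eigenspace_ad scale0r => /(_ isT)/eqP.
move=> hi hj hs; split; [exact/eqP | exact/eqP|].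
rewrite memvE; apply/subv_bigcapP => s /andP[si sj].
by rewrite -memvE mem_eigenspace_ad scale0r hs.
Qed.

Lemma mem_Espace_root i j v : i != j ->
  v \in Espace br Hl i j 1 (- 1) <-> root_vector br Hl i j v.
Proof.
move=> ij; split=> [/mem_Espace[hi hj hs] l|hv].
  have [->|li] := eqVneq l i; first by rewrite /wt (negPf ij) hi.
  have [->|lj] := eqVneq l j; first by rewrite /wt hj.
  by rewrite /wt hs // scale0r.
apply/mem_Espace; split=> [||s si sj]; rewrite hv.
- by rewrite eqxx (negPf ij).
- by rewrite eqxx eq_sym (negPf ij).
- by rewrite (negPf si) (negPf sj) scale0r.
Qed.

Lemma Espace_sym i j p q : Espace br Hl i j p q = Espace br Hl j i q p.
Proof.
apply/vspaceP => v.
by apply/mem_Espace/mem_Espace => -[hi hj hs]; split=> // s si sj; apply: hs.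
Qed.

End Espace.

(** * Subspaces and subgroups stable under an involution reversing the [Hl j] *)

Section Normalizer.
Variables (F Fbar : fieldType) (iota : {rmorphism F -> Fbar}).
Hypothesis char0 : [pchar F] =i pred0.
Variables (V : vectType F) (br : V -> V -> V) (hbr : lie_bracket br).
Variables (H0 : V) (k : nat) (Hl : 'I_k.+1 -> V) (c : 'End(V)).
Hypothesis cAut : Aut0 iota br c.
Hypothesis cH : forall j, c (Hl j) = - Hl (rev_ord j).
Hypothesis cc : (c \o c)%VF = \1%VF.
Hypothesis H0E : H0 = \sum_j Hl j.

Let cK v : c (c v) = v. Proof. by rewrite -comp_lfunE cc id_lfunE. Qed.
Let cM u v : c (br u v) = br (c u) (c v). Proof. exact: cAut.1.2. Qed.

Lemma involution_inv : (c^-1)%VF = c.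
Proof.
have /eqP c0 := cAut.1.1.
by rewrite -[LHS]comp_lfun1r -cc comp_lfunA lker0_compVf // comp_lfun1l.
Qed.

Lemma involution_limg (U W : {vspace V}) : (forall v, v \in U -> c v \in W) ->
  (forall v, v \in W -> c v \in U) -> (c @: U)%VS = W.
Proof.
move=> UW WU; apply/vspaceP => v; apply/memv_imgP/idP => [[u /UW ? -> //]|/WU cv].
by exists (c v); rewrite ?cK.
Qed.

(** As [c] is its own inverse, conjugating twice gives the converse implication. *)
Lemma involution_normalizes (S : 'End(V) -> Prop) :
  (forall f, S f -> S (c \o f \o c)%VF) -> normalizes_group c S.
Proof.
move=> hS f; rewrite involution_inv; split=> [|/hS]; first exact: hS.
by rewrite !comp_lfunA cc comp_lfun1l -comp_lfunA cc comp_lfun1r.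
Qed.

Lemma involution_H0 : c H0 = - H0.
Proof.
rewrite H0E linear_sum -sumrN [RHS](reindex_inj rev_ord_inj).
by apply: eq_bigr => j _; exact: cH.
Qed.

Lemma involution_eigenspace d v :
  v \in eigenspace_ad br H0 d -> c v \in eigenspace_ad br H0 (- d).
Proof.
rewrite !mem_eigenspace_ad // => /eqP hv.
by rewrite -[H0 in br H0]opprK -involution_H0 brNl // -cM hv linearZ scaleNr.
Qed.

Lemma involution_a0 H : H \in a0 Hl -> c H \in a0 Hl.
Proof.
move=> /memv_sumP[h hh ->]; rewrite linear_sum rpred_sum // => j _.
have /vlineP[d ->] := hh j isT; rewrite linearZ /= cH rpredZ // rpredN.
by rewrite memvE (sumv_sup (rev_ord j)).
Qed.

Lemma involution_Ggrp f : Ggrp iota br H0 f -> Ggrp iota br H0 (c \o f \o c)%VF.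
Proof.
move=> [fA fH]; split; first by apply: Aut0_comp => //; apply: Aut0_comp.
by rewrite !comp_lfunE involution_H0 linearN /= fH linearN /= involution_H0 opprK.
Qed.

Lemma involution_Lgrp f : Lgrp iota br H0 Hl f -> Lgrp iota br H0 Hl (c \o f \o c)%VF.
Proof.
move=> [fG fH]; split=> [|H Ha]; first exact: involution_Ggrp.
by rewrite !comp_lfunE fH ?involution_a0.
Qed.

(** Negating the weights exchanges the two indices and [rev_ord] reverses their order; so the
    condition [i < j] in [nspace] survives. *)
Lemma involution_root i j v : root_vector br Hl i j v ->
  root_vector br Hl (rev_ord j) (rev_ord i) (c v).
Proof.
move=> hv l; have e : Hl l = - c (Hl (rev_ord l)) by rewrite cH rev_ordK opprK.
rewrite /wt e brNl // -cM hv linearZ /= -scaleNr -rmorphN opprB.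
by rewrite -[in RHS](rev_ordK l) !(inj_eq rev_ord_inj).
Qed.

Lemma involution_nspace v : v \in nspace br Hl -> c v \in nspace br Hl.
Proof.
suff h : (c @: nspace br Hl <= nspace br Hl)%VS by move/(memv_img c)/(subvP h).
rewrite {1}/nspace limg_sum; apply/subv_sumP => i _.
rewrite limg_sum; apply/subv_sumP => j ij; apply/subvP => _ /memv_imgP[u uE ->].
have ne : i != j by rewrite neq_ltn ij.
have rr : (rev_ord j < rev_ord i)%N by rewrite /=; have := ltn_ord j; lia.
have rne : rev_ord j != rev_ord i by rewrite neq_ltn rr.
rewrite memvE (sumv_sup (rev_ord j)) // (sumv_sup (rev_ord i)) // -memvE.
by apply/mem_Espace_root => //; apply: involution_root; apply/mem_Espace_root.
Qed.

Lemma involution_exp_ad v : (c \o exp_ad br v \o c)%VF = exp_ad br (c v).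
Proof. by rewrite exp_ad_conj // -comp_lfunA cc comp_lfun1r. Qed.

Lemma involution_Ngrp f : Ngrp br Hl f -> Ngrp br Hl (c \o f \o c)%VF.
Proof.
by move=> [v vn ->]; exists (c v); rewrite ?involution_exp_ad ?involution_nspace.
Qed.

Lemma involution_Pgrp f : Pgrp iota br H0 Hl f -> Pgrp iota br H0 Hl (c \o f \o c)%VF.
Proof.
move=> [l [u [hl hu ->]]]; exists (c \o l \o c)%VF, (c \o u \o c)%VF; split.
- exact: involution_Lgrp.
- exact: involution_Ngrp.
by apply/lfunP => v; rewrite !comp_lfunE cK.
Qed.

Lemma involution_ad_a0 f : ad_a0 br Hl f <-> ad_a0 br Hl (c \o f \o c)%VF.
Proof.
have conj v : (c \o ad br v \o c)%VF = ad br (c v).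
  by apply/lfunP => u; rewrite !comp_lfunE !adE // cM cK.
split=> -[H Ha e]; exists (c H); rewrite ?involution_a0 ?e ?conj //.
rewrite -conj -e !comp_lfunA cc comp_lfun1l -comp_lfunA.
by rewrite cc comp_lfun1r.
Qed.

(** The conjugate torus has the same Lie algebra, since [c] preserves [a0]; hence it contains
    [A0]. *)
Lemma involution_A0 (A0 : 'End(V) -> Prop) : split_torus_of_G iota br H0 Hl A0 ->
  forall f, A0 f -> A0 (c \o f \o c)%VF.
Proof.
move=> [_ hA]; apply: (split_torus_sub char0 hA).
have [b [r [m [bV gen TE hE]]]] := split_torus_conj cc hA.
by exists b, r, m; split=> // f; rewrite involution_ad_a0.
Qed.

End Normalizer.

(** * From strongly orthogonal roots to commuting root vectors *)

Section Orthogonality.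
Variables (F : fieldType) (char0 : [pchar F] =i pred0).
Variables (V : vectType F) (br : V -> V -> V) (hbr : lie_bracket br).
Variables (H0 : V) (a : {vspace V}) (hH0 : H0 \in a).
Hypothesis deg_small : forall c v, br H0 v = c *: v -> v = 0 \/
  exists2 z : int, z \in [:: -2; 0; 2] & c = z%:~R.

Lemma in_root_space_br (al be : linform a) u v : in_root_space br al u ->
  in_root_space br be v -> in_root_space br (al + be) (br u v).
Proof.
move=> hu hv H Ha; rewrite brA // (hu H Ha) (hv H Ha) brZl // brZr // -scalerDl.
by rewrite /rval add_lfunE.
Qed.

Lemma root_space0 (al : linform a) v : al != 0 -> ~ is_root br al ->
  in_root_space br al v -> v = 0.
Proof.
move=> al0 nr hv; apply/eqP/negP => v0; apply: nr; split=> //.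
by exists v => //; apply/negP.
Qed.

Lemma root_degree (al : linform a) : is_root br al ->
  exists2 z : int, z \in [:: -2; 0; 2] & rval al H0 = z%:~R.
Proof.
case=> _ [v v0 /(_ _ hH0)/deg_small[/eqP|//]].
by rewrite (negPf v0).
Qed.

(* If al - be were a root, its reflection in al would be - (al + be), which
   takes the value -4 at H0. *)
Lemma descent_orthogonal (al be : linform a) (Ha Xa Ya Xb Yb : V) :
  rval al H0 = 2%:R -> rval be H0 = 2%:R -> is_coroot br al Ha ->
  sl2_triple br Ya Ha Xa ->
  in_root_space br al Xa -> in_root_space br (- al) Ya ->
  in_root_space br be Xb -> in_root_space br (- be) Yb -> Xb != 0 ->
  strongly_orthogonal br be al -> br Xb Ya = 0 /\ br Xa Yb = 0.
Proof.
move=> alH beH [Haa alHa refl] [_ _ tr] hXa hYa hXb hYb Xb0 [_ nr _ ne].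
have XbYa : br Xb Ya = 0.
  by apply: (root_space0 _ nr (in_root_space_br hXb hYa)); apply/eqP.
have XaXb : br Xa Xb = 0.
  have h := in_root_space_br hXa hXb hH0.
  case: (deg_small h) => // -[z zs]; rewrite /rval add_lfunE.
  rewrite -/(rval al H0) -/(rval be H0) alH beH -natrD -[_%:R]/((4%:Z)%:~R : F).
  by move=> /(intr_inj0 char0) e; subst z.
(* [Xb] commutes with [Xa] and [Ya], hence with [Ha = [Ya, Xa]]. *)
have beHa : rval be Ha = 0.
  have := hXb _ Haa; rewrite -tr => /esym/eqP.
  have -> : br (br Ya Xa) Xb = 0.
    have := brA hbr Ya Xa Xb; rewrite XaXb br0r // [br Ya Xb]brC // XbYa oppr0 br0r //.
    by rewrite addr0.
  by rewrite tr scaler_eq0 (negPf Xb0) orbF => /eqP.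
(* Strong orthogonality excludes [be - al]; its negative [al - be] is excluded through the
   reflection. *)
split=> //; apply: (@root_space0 (al - be)); last exact: in_root_space_br.
  by rewrite subr_eq0 eq_sym -subr_eq0; apply/eqP.
move=> /refl; rewrite /rval !add_lfunE !opp_lfunE -!/(rval _ _) alHa beHa subr0.
move=> /root_degree[z zs]; rewrite /rval !add_lfunE !opp_lfunE scale_lfunE -!/(rval _ _).
rewrite alH beH subrr sub0r -[_ *: _]/(_ * _) -natrM -[_%:R]/((4%:Z)%:~R : F) -rmorphN.
by move=> /(intr_inj0 char0) e; subst z.
Qed.

End Orthogonality.

Lemma descent_strongly_orthogonal (F : fieldType) (V : vectType F) (br : V -> V -> V)
    (H0 : V) (a : {vspace V}) (Pi : seq (linform a)) k (lam : 'I_k.+1 -> linform a) :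
  is_descent br H0 Pi lam ->
  (forall j, rval (lam j) H0 = 2%:R) /\
  (forall i j : 'I_k.+1, (i < j)%N -> strongly_orthogonal br (lam j) (lam i)).
Proof.
move=> [hlam _]; split=> [j|i j ij]; first by have [[_]] := hlam j.
have [[[Pi' [[_ base _] _ /base[_ so]]] _] _] := hlam j.
exact: so.
Qed.

Lemma graded_decomposition (F : fieldType) (V : vectType F) (br : V -> V -> V) (H0 : V) :
  lie_bracket br -> (Vminus br H0 + g0 br H0 + Vplus br H0)%VS = fullv ->
  forall v, exists vm v0 vp,
  [/\ v = vm + v0 + vp, wt br H0 (-2) vm, wt br H0 0 v0 & wt br H0 2 vp].
Proof.
move=> hbr sum v; have : v \in (Vminus br H0 + g0 br H0 + Vplus br H0)%VS.
  by rewrite sum memvf.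
move=> /memv_addP[_ /memv_addP[vm hm [v0 h0 ->]] [vp hp ->]].
move: hm h0 hp; rewrite !mem_eigenspace_ad // => /eqP hm /eqP h0 /eqP hp.
by exists vm, v0, vp; split=> //; rewrite /wt hm rmorphN.
Qed.

Lemma gamma_ij_weyl (F : fieldType) (V : vectType F) (br : V -> V -> V) k
    (x y : 'I_k.+1 -> 'I_k.+1 -> V) i j v :
  gamma_ij br x y i j v = weyl br (y i j) (x i j) v.
Proof. by rewrite weylE /gamma_ij !comp_lfunE. Qed.

Theorem theorem4p4p1
  (* F is a finite extension of Q_p, with residue characteristic not 2 *)
  (p : nat) (Qp : fieldType) (nu : Qp -> rat) (hQp : is_Qp p nu)
  (F : fieldExtType Qp) (hres : residue_char_neq2 nu F)
  (* Fbar is an algebraic closure of F *)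
  (Fbar : closedFieldType) (iota : {rmorphism F -> Fbar})
  (hFbar : forall z : Fbar, algebraicOver iota z)
  (* (gt, H0) is a simple regular graded Lie algebra *)
  (gt : vectType F) (br : gt -> gt -> gt) (hbr : lie_bracket br)
  (H0 : gt) (hreg : regular_graded iota br H0) (hsimple : lie_simple br)
  (* roots and descent; the rank is k + 1 *)
  (a : {vspace gt}) (ha : maximal_split_abelian br H0 a) (hH0 : H0 \in a)
  (Pi : seq (linform a)) (hPi : is_base (is_root br (a := a)) Pi)
  (hPi02 : forall al, al \in Pi -> rval al H0 = 0 \/ rval al H0 = 2%:R)
  (k : nat) (lam : 'I_k.+1 -> linform a) (hlam : is_descent br H0 Pi lam)
  (Hl : 'I_k.+1 -> gt) (hHl : forall j, is_coroot br (lam j) (Hl j))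
  (* A0 is the split torus of G with Lie algebra a^0 *)
  (A0 : 'End(gt) -> Prop) (hA0 : split_torus_of_G iota br H0 Hl A0)
  (* the fixed triples defining the gamma_{i,j} *)
  (x y : 'I_k.+1 -> 'I_k.+1 -> gt) (hxy : gamma_data br Hl x y)
  (* the diagonal triple *)
  (X Y : 'I_k.+1 -> gt) (hXY : diagonal_triple br H0 Hl lam X Y)
  (* n = -1 when k = 0 *)
  (n : int) (hn : k%:Z = if odd k then 2 * n + 1 else 2 * n + 2)
  (hgamma : forall i : 'I_k.+1, (i : nat)%:Z <= n ->
     gamma_ij br x y i (rev_ord i) (X i) = X (rev_ord i)) :
  (exists c : 'End(gt), involution_of iota br Hl X Y c) /\
  (forall c : 'End(gt), involution_of iota br Hl X Y c ->
    (c @: g0 br H0)%VS = g0 br H0 /\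
    (c @: Vplus br H0)%VS = Vminus br H0 /\
    (c @: Vminus br H0)%VS = Vplus br H0 /\
    normalizes_group c (Ggrp iota br H0) /\
    normalizes_group c (Pgrp iota br H0 Hl) /\
    normalizes_group c (Lgrp iota br H0 Hl) /\
    normalizes_group c A0 /\
    normalizes_group c (Ngrp br Hl)).
Proof.
have char0 : [pchar F] =i pred0.
  by move=> q; rewrite (fmorph_pchar (in_alg F)) (pchar_Qp hQp).
have grad := graded_decomposition hbr (rg_sum hreg).
have deg := deg_int hbr grad.
have [tot diag] := hXY; have [lamH0 so] := descent_strongly_orthogonal hlam.
have [_ [aC aD] _] := ha.
have Hla j : Hl j \in a by have [] := hHl j.
have triple j : sl2_triple br (Y j) (Hl j) (X j) by have [] := diag j.
have rootX j : in_root_space br (lam j) (X j) by have [] := diag j.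
have rootY j : in_root_space br (- lam j) (Y j) by have [] := diag j.
have X0 j : X j != 0 by have [] := diag j.
have degX j : wt br H0 2 (X j) by rewrite /wt rootX // lamH0.
have degY j : wt br H0 (- 2) (Y j).
  by rewrite /wt rootY // /rval opp_lfunE -/(rval _ _) lamH0 rmorphN.
have orth (i j : 'I_k.+1) : (i < j)%N -> br (X j) (Y i) = 0 /\ br (X i) (Y j) = 0.
  by move/so; apply: (descent_orthogonal char0 hbr hH0 deg (lamH0 i) (lamH0 j) (hHl i)
    (triple i) (rootX i) (rootY i) (rootX j) (rootY j) (X0 j)).
have XY0 i j : i != j -> br (X i) (Y j) = 0.
  by rewrite neq_ltn => /orP[/orth[]|/orth[]].
have H0E : H0 = \sum_j Hl j.
  have [_ _ <-] := tot; rewrite br_suml //; apply: eq_bigr => j _.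
  rewrite br_sumr // (bigD1 j) //= big1 ?addr0; first by case: (triple j).
  by move=> l lj; rewrite brC // XY0 ?oppr0.
have HlC i j : br (Hl i) (Hl j) = 0 by apply: aC.
(* Otherwise [Y ord0] would be a multiple of [X ord0], so of degree 2 as well as -2, hence zero. *)
have dimV : (1 < \dim {:gt})%N.
  rewrite ltnNge; apply/negP => le1.
  have e : <[X ord0]>%VS = fullv :> {vspace gt}.
    by apply/eqP; rewrite eqEdim subvf dim_vline X0.
  have /vlineP[d Yd] : Y ord0 \in <[X ord0]>%VS by rewrite e memvf.
  have hY : wt br H0 2 (Y ord0) by rewrite Yd; apply: wtZ.
  have Y0 : Y ord0 = 0 := wt_uniq char0 (degY ord0) hY isT.
  by have [_ _ _] := diag ord0; rewrite Y0 eqxx.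
have wtx (i : 'I_k.+1) : (i < rev_ord i)%N -> root_vector br Hl i (rev_ord i) (x i (rev_ord i)).
  move=> hi; have ne : i != rev_ord i by rewrite neq_ltn hi.
  by apply/(mem_Espace_root hbr) => //; have [] := hxy _ _ ne.
have wty (i : 'I_k.+1) : (i < rev_ord i)%N -> root_vector br Hl (rev_ord i) i (y i (rev_ord i)).
  move=> hi; have ne : i != rev_ord i by rewrite neq_ltn hi.
  apply/(mem_Espace_root hbr); first by rewrite eq_sym.
  by rewrite Espace_sym //; have [] := hxy _ _ ne.
have trxy (i : 'I_k.+1) : (i < rev_ord i)%N ->
    sl2_triple br (y i (rev_ord i)) (Hl i - Hl (rev_ord i)) (x i (rev_ord i)).
  by move=> hi; have [|] := hxy i (rev_ord i); rewrite ?neq_ltn ?hi.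
have gX (i : 'I_k.+1) : (i < rev_ord i)%N ->
    weyl br (y i (rev_ord i)) (x i (rev_ord i)) (X i) = X (rev_ord i).
  move=> hi; rewrite -hgamma ?gamma_ij_weyl //.
  (* For either parity of [k], the condition [i < k - i] amounts to [i <= n]. *)
  by move: hi hn (ltn_ord i); rewrite /=; case: ifP => _; lia.
split.
  have [s s3 [sH sX ss]] := diagonal_involution char0 hbr dimV grad triple degX degY
    XY0 H0E HlC (fun j => aD _ (Hla j)) (aD _ hH0) wtx wty trxy gX.
  have cA : Aut0 iota br (exp_prod br s).
    by split; [apply: exp_prod_aut | apply: exp_prod_elementary].
  exists (exp_prod br s); split=> //; split=> //.
  by apply: (involution_limg ss) => v; apply: involution_a0.
move=> c [[cA _] cH _ cc].
have cE := involution_eigenspace hbr cA cH H0E.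
split; [|split; [|split; [|split; [|split; [|split; [|split]]]]]].
- by apply: (involution_limg cc) => v /cE; rewrite oppr0.
- by apply: (involution_limg cc) => v /cE //; rewrite opprK.
- by apply: (involution_limg cc) => v /cE //; rewrite opprK.
- by apply: (involution_normalizes cA cc) => f; apply: (involution_Ggrp cA cH H0E).
- by apply: (involution_normalizes cA cc) => f; apply: (involution_Pgrp hbr cA cH cc H0E).
- by apply: (involution_normalizes cA cc) => f; apply: (involution_Lgrp cA cH cc H0E).
- by apply: (involution_normalizes cA cc) => f; exact: (involution_A0 char0 hbr cA cH cc hA0).
- by apply: (involution_normalizes cA cc) => f; apply: (involution_Ngrp hbr cA cH cc).
Qed.
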